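(* Let the correlation kernel $K$ be a Rational Quadratic kernel, the Squared Exponential kernel, or a Matérn kernel with smoothness $\nu\ge1$. There exists a hyperplane $\mathcal H_n$ of $\mathbb R^n$ such that, for every $\boldsymbol y\in\mathbb R^n\setminus\mathcal H_n$, when $\theta\to+\infty$, $$\left(\boldsymbol y^\top\boldsymbol W(\boldsymbol W^\top\boldsymbol\Sigma_\theta\boldsymbol W)^{-1}\boldsymbol W^\top\boldsymbol y\right)^{-1}=O(v_{n-p}(\theta)),$$ and for this hyperplane, whenever the observation vector $\boldsymbol y$ belongs to $\mathbb R^n\setminus\mathcal H_n$, $$L_{\boldsymbol y}(\theta)^2=\prod_{i=1}^{n-p}\frac{O(v_{n-p}(\theta))}{v_i(\theta)}\quad\text{when }\theta\to+\infty,$$ that is, $L_{\boldsymbol y}(\theta)^2=O\Big(\prod_{i=1}^{n-p}\frac{v_{n-p}(\theta)}{v_i(\theta)}\Big)$ when $\theta\to+\infty$.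
   Context: Let $r\ge1$, $n\ge1$, $0\le p<n$ be integers and let $\boldsymbol x^{(1)},\dots,\boldsymbol x^{(n)}\in\mathbb R^r$ be distinct fixed points. For $\theta>0$ put $K_\theta(t)=K(t/\theta)$ and let $\boldsymbol\Sigma_\theta$ be the $n\times n$ matrix with $(i,i')$-th element $K_\theta(\|\boldsymbol x^{(i)}-\boldsymbol x^{(i')}\|)$ ($\|\cdot\|$ the Euclidean norm). Kernels ($K(0)=1$ and, for $t>0$): Rational Quadratic with parameter $\nu>0$: $K(t)=(1+t^2)^{-\nu}$; Squared Exponential: $K(t)=e^{-t^2}$; Matérn with smoothness $\nu>0$: $K(t)=\Gamma(\nu)^{-1}2^{1-\nu}(2\sqrt\nu\,t)^\nu\mathcal K_\nu(2\sqrt\nu\,t)$, with $\mathcal K_\nu$ the modified Bessel function of the second kind. For these kernels $\boldsymbol\Sigma_\theta$ is symmetric positive definite. If $p\ge1$, $\boldsymbol H$ is a fixed $n\times p$ matrix of rank $p$ and $\boldsymbol W$ is a fixed $n\times(n-p)$ matrix with $\boldsymbol W^\top\boldsymbol W=\boldsymbol I_{n-p}$ and $\boldsymbol H^\top\boldsymbol W=\boldsymbol 0$. If $p=0$, terms involving $\boldsymbol H$ (and $\boldsymbol\beta$) are ignored and $\boldsymbol W$ is a fixed orthogonal $n\times n$ matrix, e.g. $\boldsymbol I_n$. Let $v_1(\theta)\ge\dots\ge v_{n-p}(\theta)>0$ be the ordered eigenvalues of $\boldsymbol W^\top\boldsymbol\Sigma_\theta\boldsymbol W$. The likelihood is $L_{\boldsymbol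 y}(\boldsymbol\beta,\sigma^2,\theta)=(2\pi\sigma^2)^{-n/2}|\boldsymbol\Sigma_\theta|^{-1/2}\exp\{-\frac1{2\sigma^2}(\boldsymbol y-\boldsymbol H\boldsymbol\beta)^\top\boldsymbol\Sigma_\theta^{-1}(\boldsymbol y-\boldsymbol H\boldsymbol\beta)\}$ and the integrated likelihood is $L_{\boldsymbol y}(\theta)=\int_0^\infty\int_{\mathbb R^p}L_{\boldsymbol y}(\boldsymbol\beta,\sigma^2,\theta)\,d\boldsymbol\beta\,\frac{d\sigma^2}{\sigma^2}$, which equals, up to a positive constant not depending on $\theta$, $|\boldsymbol W^\top\boldsymbol\Sigma_\theta\boldsymbol W|^{-1/2}\big(\boldsymbol y^\top\boldsymbol W(\boldsymbol W^\top\boldsymbol\Sigma_\theta\boldsymbol W)^{-1}\boldsymbol W^\top\boldsymbol y\big)^{-(n-p)/2}$. A hyperplane of $\mathbb R^n$ is a vector subspace of dimension $n-1$. *)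

(* Defs.v *)
From HB Require Import structures.
From mathcomp Require Import all_boot all_order all_algebra.
From mathcomp Require Import all_classical all_reals all_analysis.

Set Implicit Arguments.
Unset Strict Implicit.
Unset Printing Implicit Defensive.

Import Order.TTheory GRing.Theory Num.Theory numFieldNormedType.Exports.

Local Open Scope classical_set_scope.
Local Open Scope ring_scope.

(* Lets the library's [=O_F] accept the filter of neighbourhoods of +oo. *)
Canonical pinfty_filter_on (R : numFieldType) :=
  FilterType (pinfty_nbhs R) (@filter_filter _ _ (@proper_pinfty_nbhs R)).

Definition gamma_fun (R : realType) (nu : R) : R :=
  \int[lebesgue_measure]_(s in `]0, +oo[) (s `^ (nu - 1) * expR (- s)).

Definition hcos (R : realType) (t : R) : R := (expR t + expR (- t)) / 2.

(* Modified Bessel function of the second kind of order [nu], for [0 < z]. *)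
Definition besselK (R : realType) (nu z : R) : R :=
  \int[lebesgue_measure]_(t in `]0, +oo[) (expR (- z * hcos t) * hcos (nu * t)).

(* Kernels are functions of a distance: only their values on [0, +oo[ matter. *)
Definition rational_quadratic (R : realType) (nu t : R) : R :=
  (1 + t ^+ 2) `^ (- nu).

Definition squared_exponential (R : realType) (t : R) : R := expR (- t ^+ 2).

Definition matern (R : realType) (nu t : R) : R :=
  if t == 0 then 1
  else (gamma_fun nu)^-1 * 2 `^ (1 - nu) * (2 * Num.sqrt nu * t) `^ nu
       * besselK nu (2 * Num.sqrt nu * t).

Variant smooth_kernel (R : realType) (K : R -> R) : Prop :=
| RationalQuadratic nu of 0 < nu & K = rational_quadratic nu
| SquaredExponential of K = @squared_exponential R
| MaternKernel nu of 1 <= nu & K = matern nu.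

(* The library norm on ['rV_r] is the sup norm. *)
Definition euclidean_norm (R : realType) (r : nat) (u : 'rV[R]_r) : R :=
  Num.sqrt (\sum_(k < r) u 0 k ^+ 2).

Definition corr_mx (R : realType) (n r : nat) (K : R -> R)
    (x : 'I_n -> 'rV[R]_r) (theta : R) : 'M[R]_n :=
  \matrix_(i, j) K (euclidean_norm (x i - x j) / theta).

(* Eigenvalues with multiplicity, largest first; the [i]-th eigenvalue, counted
   from 1, is [s`_i.-1]. *)
Definition ordered_eigenvalues (R : realType) (m : nat) (A : 'M[R]_m)
    (s : seq R) : Prop :=
  sorted (fun a b : R => b <= a) s /\
  char_poly A = \prod_(a <- s) ('X - a%:P).

Definition likelihood (R : realType) (n p : nat) (H : 'M[R]_(n, p))
    (S : 'M[R]_n) (y : 'cV[R]_n) (beta : 'cV[R]_p) (sigma2 : R) : R :=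
  let e := y - H *m beta in
  (2 * pi * sigma2) `^ (- (n%:R / 2)) * (\det S) `^ (- 2^-1) *
  expR (- ((2 * sigma2)^-1 * (e^T *m invmx S *m e) 0 0)).

(* Lebesgue integral over R^p, as an iterated integral; by Tonelli's theorem it
   is the integral against p-dimensional Lebesgue measure for nonnegative
   measurable integrands. R^0 is a point of mass 1. *)
Fixpoint integral_cV (R : realType) (p : nat) : ('cV[R]_p -> \bar R) -> \bar R :=
  match p return ('cV[R]_p -> \bar R) -> \bar R with
  | 0 => fun f => f 0
  | q.+1 => fun f =>
      (\int[lebesgue_measure]_(b in setT)
         integral_cV (fun beta : 'cV[R]_q => f (col_mx (b%:M : 'cV[R]_1) beta)))%E
  end.

Definition integrated_likelihood (R : realType) (n p : nat) (H : 'M[R]_(n, p))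
    (S : 'M[R]_n) (y : 'cV[R]_n) : \bar R :=
  (\int[lebesgue_measure]_(sigma2 in `]0%R, +oo[)
     (integral_cV (fun beta => (likelihood H S y beta sigma2)%:E)
      * (sigma2^-1)%:E))%E.

(* Main.v *)
Require Import Defs.
From HB Require Import structures.
From mathcomp Require Import all_boot all_order all_algebra.
From mathcomp Require Import all_classical all_reals all_analysis.
From mathcomp Require Import measurable_realfun ring lra zify.

Set Implicit Arguments.
Unset Strict Implicit.
Unset Printing Implicit Defensive.

Import Order.TTheory GRing.Theory Num.Theory numFieldNormedType.Exports.

Local Open Scope classical_set_scope.
Local Open Scope ring_scope.

(** The three kernels are mixtures of Gaussians: K t is the integral over s > 0
of w s * exp (- phi s * t^2), with w, phi > 0 and w integrable (the gamma
integral for the rational quadratic kernel, the integral representation of the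
Bessel function for the Matern kernel).  A question about the correlation
matrices of K thus reduces to the Gaussian Gram matrices
G a = (exp (- a * |x_i - x_j|^2)), uniformly in a > 0.

Let V be the column space of W, and call moments of degree k of z in R^n the
sums of the z_i against the monomials of degree k in the points x_i.  Since the
points are distinct, the moments of degree < n determine z.  Let L be the least
degree such that no nonzero vector of V has all its moments of degree <= L equal
to zero.  There are constants c, C > 0 and a nonzero z0 in V with
  - c * min(a,1)^L * |z|^2 <= z^T G a z for all z in V and a > 0: for small a,
    expand exp (2a <x_i,x_j>) in powers of a: the term of order k contributes a
    squared norm of the moments of degree k, damped by exp (- a |x_i|^2); for
    large a use that G (a + b) is the entrywise product of G a and G b, and
    Schur's product theorem ([gauss_ge]);
  - z0^T G a z0 <= C * min(a,1)^L for all a > 0: take z0 in V with vanishing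
    moments of degree < L; then z0 annihilates the first L terms of the Taylor
    expansion of the Gaussian, because |x_i - x_j|^(2m) is a polynomial in the two
    points whose monomials have degree < L in one of them when m < L
    ([gauss_le_vanish]).
With h theta the integral of w s * min (phi s / theta^2, 1)^L, integrating over s
gives both bounds for the correlation matrix, with min(a,1)^L replaced by the same
number h theta ([mixture_pinch]).  So the smallest eigenvalue is at least
c * h theta, while the fixed vector z0 has energy at most C * h theta; no
asymptotic expansion of h or of the eigenvalues enters.  The Cauchy-Schwarz
inequality bounds (y^T z0)^2 by the product of y^T W (W^T Sigma W)^-1 W^T y and of
that energy, so the first estimate holds whenever y is not orthogonal to z0: the
hyperplane is the orthogonal complement of z0.

For the likelihood, integrating out beta is a Gaussian integral
([gaussian_integral]); the remaining quadratic form and determinant are rewritten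
in terms of W ([profile_quad], [profile_det]), and the integral over the variance
scales like a power of the quadratic form ([integral_radial]).  Hence the square of
the integrated likelihood is a constant times
(det (W^T Sigma W) * (quadratic form)^(n-p))^-1 ([integrated_likelihood_sqr]), and
the second estimate follows from the first, the determinant being the product of
the eigenvalues. *)

(** * Quadratic forms on a finite index set *)

Definition bilin (R : realType) n (A : 'I_n -> 'I_n -> R) (z w : 'I_n -> R) : R :=
  \sum_i \sum_j z i * A i j * w j.

Definition quad (R : realType) n (A : 'I_n -> 'I_n -> R) (z : 'I_n -> R) : R :=
  bilin A z z.

Definition psd (R : realType) n (A : 'I_n -> 'I_n -> R) :=
  forall z : 'I_n -> R, 0 <= quad A z.

Definition sqlen (R : realType) n (z : 'I_n -> R) : R := \sum_i z i ^+ 2.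

Lemma sqlen_ge0 (R : realType) n (z : 'I_n -> R) : 0 <= sqlen z.
Proof. by apply: sumr_ge0 => i _; apply: sqr_ge0. Qed.

Lemma bilin_mx (R : realType) n (A : 'M[R]_n) (z w : 'cV[R]_n) :
  bilin A (z^~ 0) (w^~ 0) = (z^T *m A *m w) 0 0.
Proof.
rewrite -mulmxA /bilin !mxE; apply: eq_bigr => i _; rewrite !mxE big_distrr /=.
by apply: eq_bigr => j _; rewrite mulrA.
Qed.

Lemma sqlen_mx (R : realType) n (z : 'cV[R]_n) :
  sqlen (z^~ 0) = (z^T *m z) 0 0.
Proof. by rewrite !mxE; apply: eq_bigr => i _; rewrite !mxE expr2. Qed.

Lemma eq_bilin (R : realType) n (A B : 'I_n -> 'I_n -> R) z w :
  (forall i j, A i j = B i j) -> bilin A z w = bilin B z w.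
Proof.
by move=> eqAB; apply: eq_bigr => i _; apply: eq_bigr => j _; rewrite eqAB.
Qed.

Lemma bilinD (R : realType) n (A B : 'I_n -> 'I_n -> R) z w :
  bilin (fun i j => A i j + B i j) z w = bilin A z w + bilin B z w.
Proof.
rewrite /bilin -big_split; apply: eq_bigr => i _ /=; rewrite -big_split.
by apply: eq_bigr => j _ /=; ring.
Qed.

Lemma bilinZ (R : realType) n c (A : 'I_n -> 'I_n -> R) z w :
  bilin (fun i j => c * A i j) z w = c * bilin A z w.
Proof.
rewrite /bilin big_distrr; apply: eq_bigr => i _ /=; rewrite big_distrr.
by apply: eq_bigr => j _ /=; ring.
Qed.

Lemma bilin_sum (R : realType) n (I : Type) (s : seq I) (A : I -> 'I_n -> 'I_n -> R) z w :
  bilin (fun i j => \sum_(k <- s) A k i j) z w = \sum_(k <- s) bilin (A k) z w.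
Proof.
elim: s => [|k s IH].
  rewrite big_nil /bilin big1 // => i _; rewrite big1 // => j _.
  by rewrite big_nil mulr0 mul0r.
rewrite big_cons -IH -bilinD; congr bilin; apply/funext => i; apply/funext => j.
by rewrite big_cons.
Qed.

Lemma bilin_hadamard (R : realType) n (A : 'I_n -> 'I_n -> R) (f g z w : 'I_n -> R) :
  bilin (fun i j => A i j * (f i * g j)) z w
  = bilin A (fun i => z i * f i) (fun j => w j * g j).
Proof. by apply: eq_bigr => i _; apply: eq_bigr => j _; ring. Qed.

Lemma bilinC (R : realType) n (A : 'I_n -> 'I_n -> R) z w :
  (forall i j, A i j = A j i) -> bilin A w z = bilin A z w.
Proof.
move=> Asym; rewrite /bilin exchange_big; apply: eq_bigr => i _ /=.
by apply: eq_bigr => j _; rewrite Asym; ring.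
Qed.

Lemma quad_comb (R : realType) n (A : 'I_n -> 'I_n -> R) (a b : R) z w :
  (forall i j, A i j = A j i) ->
  quad A (fun i => a * z i + b * w i)
  = a ^+ 2 * quad A z + 2 * a * b * bilin A z w + b ^+ 2 * quad A w.
Proof.
move=> Asym; have -> : 2 * a * b * bilin A z w = a * b * bilin A z w + a * b * bilin A w z.
  by rewrite (bilinC z w Asym); ring.
rewrite /quad /bilin !mulr_sumr -!big_split.
apply: eq_bigr => i _ /=; rewrite !mulr_sumr -!big_split.
by apply: eq_bigr => j _ /=; ring.
Qed.

(** When the energy of w is zero, nonnegativity of the energy of z + s * w for all s
forces the mixed term to vanish; otherwise take the minimising combination. *)
Lemma psd_cauchy_schwarz (R : realType) n (A : 'I_n -> 'I_n -> R) z w :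
  (forall i j, A i j = A j i) -> psd A ->
  bilin A z w ^+ 2 <= quad A z * quad A w.
Proof.
move=> Asym psdA.
set a := quad A z; set b := bilin A z w; set c := quad A w.
have H s u : 0 <= s ^+ 2 * a + 2 * s * u * b + u ^+ 2 * c.
  by rewrite -quad_comb//; apply: psdA.
have c0 : 0 <= c by apply: psdA.
have [c_eq0|c_neq0] := eqVneq c 0.
  have [b_eq0|b_neq0] := eqVneq b 0; first by rewrite b_eq0 c_eq0; lra.
  have := H 1 (- (a + 1) / (2 * b)); rewrite c_eq0.
  rewrite (_ : _ + _ = -1) ?ler0N1//.
  by field.
have c_gt0 : 0 < c by rewrite lt_def c_neq0.
have := H c (- b).
rewrite (_ : _ + _ = c * (a * c - b ^+ 2)); last by ring.
by rewrite pmulr_rge0// subr_ge0.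
Qed.

Lemma quadD_le (R : realType) n (A : 'I_n -> 'I_n -> R) z w :
  (forall i j, A i j = A j i) -> psd A ->
  quad A (fun i => z i + w i) <= 2 * quad A z + 2 * quad A w.
Proof.
move=> Asym psdA.
have := psdA (fun i => 1 * z i + (-1) * w i); rewrite quad_comb//.
have -> : (fun i => z i + w i) = (fun i => 1 * z i + 1 * w i).
  by apply/funext => i; rewrite !mul1r.
rewrite quad_comb//; lra.
Qed.

Lemma quad_ub (R : realType) n (A : 'I_n -> 'I_n -> R) z :
  quad A z <= (\sum_i \sum_j `|A i j|) * sqlen z.
Proof.
rewrite /quad /bilin big_distrl; apply: ler_sum => i _ /=.
rewrite big_distrl; apply: ler_sum => j _ /=.
have le_sqlen k : z k ^+ 2 <= sqlen z.
  by rewrite /sqlen (bigD1 k)//= lerDl; apply: sumr_ge0 => l _; apply: sqr_ge0.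
have zz : `|z i * z j| <= sqlen z.
  have [h|h] := ger0P (z i * z j); have := le_sqlen i; have := le_sqlen j;
    have := sqr_ge0 (z i - z j); have := sqr_ge0 (z i + z j); lra.
apply: (@le_trans _ _ `|A i j * (z i * z j)|).
  by rewrite [leLHS](_ : _ = A i j * (z i * z j)) ?ler_norm//; ring.
by rewrite normrM ler_wpM2l.
Qed.

Lemma pd_unitmx (R : realType) m (A : 'M[R]_m) :
  (forall t : 'cV_m, t != 0 -> 0 < (t^T *m A *m t) 0 0) -> A \in unitmx.
Proof.
move=> pdA; rewrite unitmxE unitfE; apply/negP => /det0P[v v_neq0 vA].
have := pdA v^T; rewrite trmxK vA mul0mx mxE ltxx => H.
by suff: false by []; apply: H; rewrite trmx_eq0.
Qed.

Lemma pd_psd (R : realType) m (A : 'M[R]_m) :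
  (forall t : 'cV_m, t != 0 -> 0 < (t^T *m A *m t) 0 0) -> psd A.
Proof.
move=> pdA z; pose t : 'cV[R]_m := \col_i z i.
have -> : z = t^~ 0 by apply/funext => i; rewrite mxE.
rewrite /quad bilin_mx; have [->|/pdA/ltW//] := eqVneq t 0.
by rewrite mulmx0 mxE.
Qed.

(** The squared coordinate z_i^2 is the squared A-product of z with the i-th column of
A^-1, so by Cauchy-Schwarz the sum of the z_i^2 is at most tr(A^-1) times the
energy of z.  This replaces a compactness argument on the unit sphere. *)
Lemma pd_ge_sqlen (R : realType) m (A : 'M[R]_m) : A^T = A ->
  (forall t : 'cV_m, t != 0 -> 0 < (t^T *m A *m t) 0 0) ->
  exists2 c : R, 0 < c & forall t : 'cV_m, c * sqlen (t^~ 0) <= (t^T *m A *m t) 0 0.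
Proof.
move=> Asym pdA.
have Aunit := pd_unitmx pdA; have psdA := pd_psd pdA.
have Afun i j : A i j = A j i by rewrite -{1}Asym mxE.
pose d := \sum_i (invmx A) i i.
have diag i : quad A ((invmx A *m delta_mx i (0 : 'I_1))^~ 0) = (invmx A) i i.
  rewrite /quad bilin_mx trmx_mul trmx_inv Asym trmx_delta.
  rewrite -[_ *m A]mulmxA mulVmx// mulmx1 mulmxA -rowE.
  by rewrite -colE !mxE.
have d_ge0 : 0 <= d by apply: sumr_ge0 => i _; rewrite -diag; apply: psdA.
exists (1 + d)^-1; first by rewrite invr_gt0; lra.
move=> t; rewrite mulrC ler_pdivrMr; last lra.
have q_ge0 : 0 <= (t^T *m A *m t) 0 0 by rewrite -bilin_mx; apply: psdA.
apply: (@le_trans _ _ ((t^T *m A *m t) 0 0 * d)); last first.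
  by apply: ler_wpM2l => //; lra.
rewrite /sqlen /d mulr_sumr; apply: ler_sum => i _.
have := psd_cauchy_schwarz ((invmx A *m delta_mx i (0 : 'I_1))^~ 0) (t^~ 0) Afun psdA.
rewrite diag /quad !bilin_mx trmx_mul trmx_inv Asym trmx_delta.
by rewrite -[_ *m A]mulmxA mulVmx// mulmx1 -rowE mxE mulrC.
Qed.

(** * Moments of a weighted point configuration and Gaussian Gram matrices *)

Definition dot (R : realType) r (u v : 'rV[R]_r) : R := \sum_k u 0 k * v 0 k.

Lemma bilin_hadamard_dot (R : realType) n r (x : 'I_n -> 'rV[R]_r)
    (A : 'I_n -> 'I_n -> R) z w :
  bilin (fun i j => A i j * dot (x i) (x j)) z w
  = \sum_k bilin A (fun i => z i * x i 0 k) (fun j => w j * x j 0 k).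
Proof.
under eq_bigr do rewrite -bilin_hadamard.
rewrite -bilin_sum; congr bilin; apply/funext => i; apply/funext => j.
by rewrite big_distrr.
Qed.

(** An instance of Schur's product theorem: multiplying entrywise by <x_i,x_j> amounts to
summing, over the coordinates c, the form evaluated at the vectors z_i * x_i(c). *)
Lemma psd_hadamard_dotX (R : realType) n r (x : 'I_n -> 'rV[R]_r)
    (A : 'I_n -> 'I_n -> R) k :
  psd A -> psd (fun i j => A i j * dot (x i) (x j) ^+ k).
Proof.
elim: k A => [|k IH] A psdA z.
  rewrite /quad (_ : (fun i j => _) = A) ?psdA//.
  by apply/funext => i; apply/funext => j; rewrite expr0 mulr1.
rewrite (_ : (fun i j => _) =
   (fun i j => A i j * dot (x i) (x j) * dot (x i) (x j) ^+ k)); last first.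
  by apply/funext => i; apply/funext => j; rewrite exprS mulrA.
apply: IH => w; rewrite /quad bilin_hadamard_dot; apply: sumr_ge0 => c _.
exact: psdA.
Qed.

(** Each term of the exponential series contributes a nonnegative form, so the full sum
dominates every partial sum; N = 0 gives positivity. *)
Lemma hadamard_exp_ge (R : realType) n r (x : 'I_n -> 'rV[R]_r)
    (A : 'I_n -> 'I_n -> R) (b : R) (N : nat) z :
  psd A -> 0 <= b ->
  \sum_(0 <= k < N) b ^+ k / k`!%:R * quad (fun i j => A i j * dot (x i) (x j) ^+ k) z
  <= quad (fun i j => A i j * expR (b * dot (x i) (x j))) z.
Proof.
move=> psdA b0.
pose u M : R := \sum_(0 <= k < M) b ^+ k / k`!%:R *
  quad (fun i j => A i j * dot (x i) (x j) ^+ k) z.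
have uE M : u M =
  quad (fun i j => A i j * series (exp_coeff (b * dot (x i) (x j))) M) z.
  rewrite /u.
  under eq_bigr do rewrite -bilinZ.
  rewrite /quad -bilin_sum; congr bilin; apply/funext => i; apply/funext => j.
  rewrite /series /= big_distrr /=; apply: eq_bigr => k _.
  by rewrite /exp_coeff /= exprMn; ring.
have u_cvg : u @ \oo --> quad (fun i j => A i j * expR (b * dot (x i) (x j))) z.
  rewrite (_ : u = fun M =>
    quad (fun i j => A i j * series (exp_coeff (b * dot (x i) (x j))) M) z).
    apply: cvg_big => //; first exact: add_continuous.
    move=> i _; apply: cvg_big => //; first exact: add_continuous.
    move=> j _; apply: cvgM; last exact: cvg_cst.
    apply: cvgM; first exact: cvg_cst.
    apply: cvgM; first exact: cvg_cst.
    exact: is_cvg_series_exp_coeff.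
  exact/funext.
have u_nd : nondecreasing_seq u.
  apply/nondecreasing_seqP => M; rewrite /u big_nat_recr//= lerDl.
  apply: mulr_ge0; first by rewrite divr_ge0 ?exprn_ge0.
  exact: psd_hadamard_dotX.
have := nondecreasing_cvgn_le u_nd (cvgP _ u_cvg) N.
by rewrite (cvg_lim _ u_cvg).
Qed.

Definition sqdist (R : realType) r (u v : 'rV[R]_r) : R := \sum_k (u 0 k - v 0 k) ^+ 2.

Lemma sqdistE (R : realType) r (u v : 'rV[R]_r) :
  sqdist u v = dot u u + dot v v - 2 * dot u v.
Proof.
rewrite /sqdist /dot mulr_sumr -sumrN -!big_split; apply: eq_bigr => k _ /=; ring.
Qed.

Lemma sqdist_ge0 (R : realType) r (u v : 'rV[R]_r) : 0 <= sqdist u v.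
Proof. by apply: sumr_ge0 => k _; apply: sqr_ge0. Qed.

Definition gauss (R : realType) n r (x : 'I_n -> 'rV[R]_r) (a : R) (i j : 'I_n) : R :=
  expR (- (a * sqdist (x i) (x j))).

(** The factor left when exp (2a <x_i,x_j>) is extracted from the Gaussian. *)
Definition damp (R : realType) n r (x : 'I_n -> 'rV[R]_r) (a : R) (i : 'I_n) : R :=
  expR (- (a * dot (x i) (x i))).

Lemma gaussE (R : realType) n r (x : 'I_n -> 'rV[R]_r) (a : R) i j :
  gauss x a i j = expR (2 * a * dot (x i) (x j)) * (damp x a i * damp x a j).
Proof. by rewrite /gauss /damp -!expRD sqdistE; congr expR; ring. Qed.

Lemma hadamard_gauss_ge (R : realType) n r (x : 'I_n -> 'rV[R]_r)
    (A : 'I_n -> 'I_n -> R) (a : R) (N : nat) z :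
  psd A -> 0 <= a ->
  \sum_(0 <= k < N) (2 * a) ^+ k / k`!%:R *
     quad (fun i j => A i j * dot (x i) (x j) ^+ k) (fun i => z i * damp x a i)
  <= quad (fun i j => A i j * gauss x a i j) z.
Proof.
move=> psdA a0; apply: le_trans.
  by apply: (hadamard_exp_ge x N _ psdA (b := 2 * a)); rewrite mulr_ge0.
rewrite /quad -bilin_hadamard le_eqVlt; apply/orP; left; apply/eqP.
by apply: eq_bilin => i j; rewrite gaussE -mulrA.
Qed.

(** The squared Euclidean norm of the tensor of moments of degree k, i.e. of the sum of
the k-fold tensor powers of the x_i weighted by the z_i. *)
Definition moment (R : realType) n r (x : 'I_n -> 'rV[R]_r) k (z : 'I_n -> R) : R :=
  quad (fun i j => dot (x i) (x j) ^+ k) z.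

Lemma psd_const1 (R : realType) n : psd (fun _ _ : 'I_n => 1 : R).
Proof.
move=> z; rewrite /quad /bilin (_ : \sum_i _ = (\sum_i z i) ^+ 2) ?sqr_ge0//.
rewrite expr2 big_distrl; apply: eq_bigr => i _ /=; rewrite big_distrr.
by apply: eq_bigr => j _ /=; ring.
Qed.

Lemma moment_ge0 (R : realType) n r (x : 'I_n -> 'rV[R]_r) k z : 0 <= moment x k z.
Proof.
have := psd_hadamard_dotX x k (@psd_const1 R n) z.
by rewrite /quad (eq_bilin _ _ (fun i j => mul1r (dot (x i) (x j) ^+ k))).
Qed.

Lemma moment0 (R : realType) n r (x : 'I_n -> 'rV[R]_r) z :
  moment x 0 z = (\sum_i z i) ^+ 2.
Proof.
rewrite expr2 big_distrl; apply: eq_bigr => i _ /=; rewrite big_distrr.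
by apply: eq_bigr => j _ /=; rewrite expr0; ring.
Qed.

Lemma momentS (R : realType) n r (x : 'I_n -> 'rV[R]_r) k z :
  moment x k.+1 z = \sum_c moment x k (fun i => z i * x i 0 c).
Proof.
by rewrite -bilin_hadamard_dot; apply: eq_bilin => i j; rewrite exprSr.
Qed.

(** For a <= 1 the coefficients of degree <= N of the exponential series are all at least
a^N / N!. *)
Lemma gauss_ge_moments (R : realType) n r (x : 'I_n -> 'rV[R]_r) (a : R) (N : nat) z :
  0 <= a <= 1 ->
  a ^+ N / N`!%:R * \sum_(k < N.+1) moment x k (fun i => z i * damp x a i)
  <= quad (gauss x a) z.
Proof.
move=> /andP[a0 a1].
have -> : gauss x a = (fun i j => 1 * gauss x a i j).
  by apply/funext => i; apply/funext => j; rewrite mul1r.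
apply: le_trans (hadamard_gauss_ge x N.+1 z (@psd_const1 R n) a0).
rewrite big_mkord big_distrr /=; apply: ler_sum => k _.
rewrite (_ : quad _ _ = moment x k (fun i => z i * damp x a i)); last first.
  by apply: eq_bilin => i j; rewrite mul1r.
apply: ler_wpM2r; first exact: moment_ge0.
apply: ler_pM; rewrite ?exprn_ge0 ?invr_ge0//.
  apply: (@le_trans _ _ (a ^+ k)).
    by apply: ler_wiXn2l => //; rewrite -ltnS.
  by rewrite exprMn ler_peMl ?exprn_ge0// exprn_ege1// ler1n.
rewrite lef_pV2 ?posrE ?ltr0n ?fact_gt0// ler_nat.
by apply: leq_fact; rewrite -ltnS.
Qed.

(** * Vanishing moments *)

(** The moments of degree < p of the measure putting mass z_i at x_i are zero.  Peeling
off one coordinate at a time makes it stable under multiplication of the weights by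
polynomials, at the price of the degree. *)
Fixpoint vanish (R : realType) n r (x : 'I_n -> 'rV[R]_r) (p : nat) (z : 'I_n -> R) : Prop :=
  if p is q.+1 then
    \sum_i z i = 0 /\ forall c, vanish x q (fun i => z i * x i 0 c)
  else True.

Lemma vanishW (R : realType) n r (x : 'I_n -> 'rV[R]_r) p z :
  vanish x p.+1 z -> vanish x p z.
Proof.
by elim: p z => [//|p IH] z [z0 zc]; split=> // c; apply: IH; apply: zc.
Qed.

Lemma vanish_pred (R : realType) n r (x : 'I_n -> 'rV[R]_r) p z c :
  vanish x p z -> vanish x p.-1 (fun i => z i * x i 0 c).
Proof. by case: p => [//|p [_ h]]; apply: h. Qed.

Lemma vanish0 (R : realType) n r (x : 'I_n -> 'rV[R]_r) p : vanish x p (fun _ => 0).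
Proof.
elim: p => [//|p IH]; split=> [|c]; first by rewrite big1.
by rewrite (_ : (fun i => _) = fun=> 0)//; apply/funext => i; rewrite mul0r.
Qed.

Lemma vanishD (R : realType) n r (x : 'I_n -> 'rV[R]_r) p z w :
  vanish x p z -> vanish x p w -> vanish x p (fun i => z i + w i).
Proof.
elim: p z w => [//|p IH] z w [z0 zc] [w0 wc]; split=> [|c].
  by rewrite big_split /= z0 w0 addr0.
rewrite (_ : (fun i => _) = fun i => z i * x i 0 c + w i * x i 0 c).
    by apply: IH; [apply: zc|apply: wc].
by apply/funext => i; rewrite mulrDl.
Qed.

Lemma vanishZ (R : realType) n r (x : 'I_n -> 'rV[R]_r) p z a :
  vanish x p z -> vanish x p (fun i => z i * a).
Proof.
elim: p z => [//|p IH] z [z0 zc]; split=> [|c].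
  by rewrite -big_distrl /= z0 mul0r.
rewrite (_ : (fun i => _) = fun i => z i * x i 0 c * a).
    by apply: IH; apply: zc.
by apply/funext => i; ring.
Qed.

Lemma vanish_dot (R : realType) n r (x : 'I_n -> 'rV[R]_r) p z :
  vanish x p z -> vanish x p.-2 (fun i => z i * dot (x i) (x i)).
Proof.
move=> zp.
rewrite (_ : (fun i => _) = fun i => \sum_c z i * x i 0 c * x i 0 c); last first.
  by apply/funext => i; rewrite big_distrr; apply: eq_bigr => c _ /=; ring.
elim: (index_enum _) => [|c s IH].
  rewrite (_ : (fun i => _) = fun=> 0); first exact: vanish0.
  by apply/funext => i; rewrite big_nil.
rewrite (_ : (fun i => _) = fun i =>
  z i * x i 0 c * x i 0 c + \sum_(c <- s) z i * x i 0 c * x i 0 c); last first.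
  by apply/funext => i; rewrite big_cons.
by apply: vanishD => //; apply: vanish_pred; apply: vanish_pred.
Qed.

Lemma vanish_moments (R : realType) n r (x : 'I_n -> 'rV[R]_r) p z :
  (forall k, (k < p)%N -> moment x k z = 0) -> vanish x p z.
Proof.
elim: p z => [//|p IH] z mz; split=> [|c].
  by have /eqP := mz 0%N isT; rewrite moment0 sqrf_eq0 => /eqP.
apply: IH => k kp; have /eqP := mz k.+1 kp.
rewrite momentS psumr_eq0 => [/allP/(_ c)|i _]; last exact: moment_ge0.
by rewrite mem_index_enum => /(_ isT)/eqP.
Qed.

(** The function f is a product of affine functions, one for each point of s, that vanishes
at that point but not at x_i. *)
Lemma vanish_separate (R : realType) n r (x : 'I_n -> 'rV[R]_r) p z i (s : seq 'I_n) :
  injective x -> i \notin s -> vanish x (size s + p) z ->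
  exists f : 'I_n -> R,
    [/\ f i != 0, forall j, j \in s -> f j = 0 & vanish x p (fun j => z j * f j)].
Proof.
move=> x_inj; elim: s p => [|k s IH] p.
  move=> _ zp; exists (fun=> 1); split=> //.
  by rewrite (_ : (fun j => _) = z)//; apply/funext => j; rewrite mulr1.
rewrite inE negb_or => /andP[ik isn] zp.
have [f [fi fs zf]] : exists f : 'I_n -> R, [/\ f i != 0,
    forall j, j \in s -> f j = 0 & vanish x p.+1 (fun j => z j * f j)].
  by apply: IH => //; rewrite addnS.
have [c xc] : exists c, x i 0 c != x k 0 c.
  apply/existsP; rewrite -negb_forall; apply/negP => /forallP xik.
  move/negP: ik; apply; apply/eqP/x_inj/rowP => c; exact/eqP.
exists (fun j => f j * (x j 0 c - x k 0 c)); split.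
- by rewrite mulf_neq0// subr_eq0.
- by move=> j; rewrite inE => /predU1P[->|/fs->]; rewrite ?subrr ?mulr0 ?mul0r.
- rewrite (_ : (fun j => _) =
    fun j => z j * f j * x j 0 c + z j * f j * - x k 0 c); last first.
    by apply/funext => j; ring.
  apply: vanishD; first by case: zf => _; apply.
  by apply: vanishZ; apply: vanishW.
Qed.

(** Integrate the interpolation polynomial that vanishes at all points but x_i; it has
degree n - 1. *)
Lemma vanish_eq0 (R : realType) n r (x : 'I_n -> 'rV[R]_r) z :
  injective x -> vanish x n z -> forall i, z i = 0.
Proof.
move=> x_inj zn i.
have nE : n = (size (rem i (enum 'I_n)) + 1)%N.
  rewrite size_rem ?mem_enum// size_enum_ord addn1 prednK//.
  exact: leq_ltn_trans (ltn_ord i).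
have irem : i \notin rem i (enum 'I_n) by rewrite mem_rem_uniqF// enum_uniq.
have : vanish x (size (rem i (enum 'I_n)) + 1) z by rewrite -nE.
move=> /(vanish_separate x_inj irem)[f [fi fs [+ _]]].
rewrite (bigD1 i)//= big1 ?addr0 => [/eqP|j ji].
  by rewrite mulf_eq0 (negPf fi) orbF => /eqP.
by rewrite fs ?mulr0// mem_rem_uniq ?enum_uniq// inE ji mem_enum.
Qed.

(** Expanding one factor |x_i - x_j|^2 = |x_i|^2 + |x_j|^2 - 2 <x_i,x_j> lowers p + q by 2
in total, whichever term is chosen, until one of the two weights has zero total mass. *)
Lemma bilin_sqdistX (R : realType) n r (x : 'I_n -> 'rV[R]_r) m p q z w :
  vanish x p z -> vanish x q w -> (m.*2 < p + q)%N ->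
  bilin (fun i j => sqdist (x i) (x j) ^+ m) z w = 0.
Proof.
elim: m p q z w => [|m IH] p q z w zp wq mpq.
  have -> : bilin (fun i j => sqdist (x i) (x j) ^+ 0) z w = (\sum_i z i) * \sum_j w j.
    rewrite big_distrl; apply: eq_bigr => i _ /=; rewrite big_distrr.
    by apply: eq_bigr => j _ /=; rewrite expr0; ring.
  case: p zp mpq => [_|p [-> _] _]; last by rewrite mul0r.
  by case: q wq => [//|q [-> _] _]; rewrite mulr0.
pose B := fun i j => sqdist (x i) (x j) ^+ m.
have -> : bilin (fun i j => sqdist (x i) (x j) ^+ m.+1) z w =
   bilin B (fun i => z i * dot (x i) (x i)) w +
   bilin B z (fun j => w j * dot (x j) (x j)) +
   - 2 * \sum_c bilin B (fun i => z i * x i 0 c) (fun j => w j * x j 0 c).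
  rewrite -bilin_hadamard_dot -bilinZ.
  rewrite -(_ : bilin (fun i j => B i j * (dot (x i) (x i) * 1)) z w =
     bilin B (fun i => z i * dot (x i) (x i)) w); last first.
    rewrite bilin_hadamard; congr bilin; apply/funext => j; exact: mulr1.
  rewrite -(_ : bilin (fun i j => B i j * (1 * dot (x j) (x j))) z w =
     bilin B z (fun j => w j * dot (x j) (x j))); last first.
    rewrite bilin_hadamard; congr bilin; apply/funext => j; exact: mulr1.
  rewrite -!bilinD; apply: eq_bilin => i j.
  by rewrite exprSr {2}sqdistE /B; ring.
have mpq' : (m.*2 < p.-2 + q)%N /\ (m.*2 < p + q.-2)%N /\ (m.*2 < p.-1 + q.-1)%N.
  by split; [lia|split; lia].
case: mpq' => [h1 [h2 h3]].
rewrite (IH p.-2 q)//; last exact: vanish_dot.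
rewrite (IH p q.-2)//; last exact: vanish_dot.
rewrite big1 ?mulr0 ?addr0// => c _.
by rewrite (IH p.-1 q.-1)//; apply: vanish_pred.
Qed.

Lemma expR_taylor_le (R : realType) (L : nat) (u : R) :
  `|expR u - \sum_(0 <= k < L) u ^+ k / k`!%:R| <= `|u| ^+ L * expR `|u|.
Proof.
rewrite (_ : \sum_(0 <= k < L) _ = series (exp_coeff u) L)//.
have cu : (series (exp_coeff u) M - series (exp_coeff u) L) @[M --> \oo] -->
    expR u - series (exp_coeff u) L.
  by apply: cvgB; [exact: is_cvg_series_exp_coeff|exact: cvg_cst].
have cu' := @cvg_norm _ _ _ _ _ _ _ cu.
apply: (cvgr_to_le (cu' _)).
near=> M.
have LM : (L <= M)%N by near: M; exact: nbhs_infty_ge.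
rewrite /series /= (big_cat_nat (leq0n L) LM)//= addrAC subrr add0r.
apply: le_trans (ler_norm_sum _ _ _) _.
apply: (@le_trans _ _ (\sum_(L <= k < M) `|u| ^+ L * exp_coeff `|u| (k - L)%N)).
  apply: ler_sum_nat => k /andP[Lk _]; rewrite /exp_coeff /= normrM normrX.
  rewrite -{1}(subnKC Lk) exprD -mulrA (ger0_norm (_ : 0 <= k`!%:R^-1)) ?invr_ge0//.
  apply: ler_wpM2l; first by rewrite exprn_ge0.
  apply: ler_wpM2l; first by rewrite exprn_ge0.
  rewrite lef_pV2 ?posrE ?ltr0n ?fact_gt0// ler_nat.
  by apply: leq_fact; rewrite leq_subr.
rewrite -mulr_sumr; apply: ler_wpM2l; first by rewrite exprn_ge0.
rewrite -{1}(add0n L) big_addn; under eq_bigr do rewrite addnK.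
apply: nondecreasing_cvgn_le (is_cvg_series_exp_coeff _) (M - L)%N.
apply/nondecreasing_seqP => N; rewrite /series /= big_nat_recr//= lerDl.
by rewrite /exp_coeff /= divr_ge0 ?exprn_ge0.
Unshelve. all: by end_near.
Qed.

Lemma quad_le_abs (R : realType) n (A B : 'I_n -> 'I_n -> R) z :
  (forall i j, `|A i j| <= B i j) ->
  quad A z <= \sum_i \sum_j `|z i| * B i j * `|z j|.
Proof.
move=> AB; apply: ler_sum => i _; apply: ler_sum => j _.
apply: le_trans (ler_norm _) _; rewrite !normrM.
by apply: ler_wpM2r => //; apply: ler_wpM2l.
Qed.

(** The Taylor polynomial of order L of the Gaussian contributes nothing to the energy of z,
so only a remainder of order a^L is left. *)
Lemma gauss_le_vanish (R : realType) n r (x : 'I_n -> 'rV[R]_r) L z :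
  vanish x L z ->
  exists2 C : R, 0 < C & forall a, 0 <= a ->
    quad (gauss x a) z <= C * Num.min a 1 ^+ L.
Proof.
move=> zL.
pose d i j := sqdist (x i) (x j).
pose b i j := d i j ^+ L * expR (d i j) + 1.
pose C := \sum_i \sum_j `|z i| * b i j * `|z j|.
have d_ge0 i j : 0 <= d i j by exact: sqdist_ge0.
have b_ge i j : 0 <= d i j ^+ L * expR (d i j) by rewrite mulr_ge0 ?exprn_ge0 ?expR_ge0.
have C_ge0 : 0 <= C.
  apply: sumr_ge0 => i _; apply: sumr_ge0 => j _.
  by rewrite !mulr_ge0// addr_ge0.
exists (1 + C); first lra.
move=> a a_ge0.
have [a1|/ltW a1] := lerP a 1; last first.
  rewrite expr1n mulr1; apply: (@le_trans _ _ C); last lra.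
  apply: quad_le_abs => i j; rewrite ger0_norm ?expR_ge0//.
  apply: (@le_trans _ _ 1); last by rewrite /b lerDr.
  by rewrite -expR0 ler_expR oppr_le0; apply: mulr_ge0 => //; exact: d_ge0.
pose T i j := \sum_(0 <= k < L) (- (a * d i j)) ^+ k / k`!%:R.
have T0 : quad T z = 0.
  rewrite /quad bilin_sum big1_seq// => k; rewrite mem_index_iota => /andP[_ kL].
  rewrite (@eq_bilin _ _ _ (fun i j => (- a) ^+ k / k`!%:R * d i j ^+ k)).
    rewrite bilinZ (bilin_sqdistX zL zL) ?mulr0//.
    by rewrite addnn ltn_double.
  by move=> i j; rewrite -mulNr exprMn; ring.
have -> : quad (gauss x a) z = quad (fun i j => gauss x a i j + (-1) * T i j) z.
  by rewrite /quad bilinD bilinZ -/(quad T z) T0 mulr0 addr0.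
apply: (@le_trans _ _ (a ^+ L * C)); last first.
  rewrite mulrC; apply: ler_wpM2r; first exact: exprn_ge0.
  by rewrite lerDr.
have -> : a ^+ L * C = \sum_i \sum_j `|z i| * (a ^+ L * b i j) * `|z j|.
  rewrite /C mulr_sumr; apply: eq_bigr => i _; rewrite mulr_sumr.
  by apply: eq_bigr => j _; ring.
apply: quad_le_abs => i j; rewrite mulN1r.
have ad0 : 0 <= a * d i j by rewrite mulr_ge0.
apply: le_trans (expR_taylor_le _ _) _.
rewrite normrN ger0_norm// exprMn -mulrA; apply: ler_wpM2l; first by rewrite exprn_ge0.
rewrite /b ler_wpDr//; apply: ler_wpM2l; first by rewrite exprn_ge0 ?d_ge0.
by rewrite ler_expR ler_piMl ?d_ge0.
Qed.

(** * Gaussian Gram matrices in the flat limit *)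

Lemma dotC (R : realType) r (u v : 'rV[R]_r) : dot u v = dot v u.
Proof. by apply: eq_bigr => k _; rewrite mulrC. Qed.

Lemma sqdistxx (R : realType) r (u : 'rV[R]_r) : sqdist u u = 0.
Proof. by rewrite /sqdist big1// => k _; rewrite subrr expr0n. Qed.

Lemma sqlen_gt0 (R : realType) n (z : 'cV[R]_n) : z != 0 -> 0 < sqlen (z^~ 0).
Proof.
move=> z0; rewrite lt_def sqlen_ge0 andbT; apply: contra_neq z0 => sz.
apply/colP => i; rewrite mxE; apply/eqP; rewrite -sqrf_eq0.
have /eqP := sz; rewrite psumr_eq0; last by move=> *; apply: sqr_ge0.
by move=> /allP/(_ i); rewrite mem_index_enum => /(_ isT).
Qed.

Definition moments (R : realType) n r (x : 'I_n -> 'rV[R]_r) N (z : 'I_n -> R) : R :=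
  \sum_(k < N) moment x k z.

(** Polynomials of degree < N separate the column space of W. *)
Definition separating (R : realType) n r (x : 'I_n -> 'rV[R]_r) m (W : 'M[R]_(n, m)) N :=
  forall t : 'cV_m, t != 0 -> 0 < moments x N ((W *m t)^~ 0).

Lemma momentsE (R : realType) n r (x : 'I_n -> 'rV[R]_r) N z :
  moments x N z = quad (fun i j => \sum_(k < N) dot (x i) (x j) ^+ k) z.
Proof. by rewrite /quad bilin_sum. Qed.

Lemma moments_ge0 (R : realType) n r (x : 'I_n -> 'rV[R]_r) N z : 0 <= moments x N z.
Proof. by apply: sumr_ge0 => k _; apply: moment_ge0. Qed.

Lemma moments_vanish (R : realType) n r (x : 'I_n -> 'rV[R]_r) N z :
  moments x N z <= 0 -> vanish x N z.
Proof.
move=> h; apply: vanish_moments => k kN.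
have /eqP : moments x N z = 0 by apply/eqP; rewrite eq_le h moments_ge0.
rewrite psumr_eq0 => [/allP/(_ (Ordinal kN))|i _]; last exact: moment_ge0.
by rewrite mem_index_enum => /(_ isT)/eqP.
Qed.

Lemma isometry_sqlen (R : realType) n m (W : 'M[R]_(n, m)) (t : 'cV[R]_m) :
  W^T *m W = 1%:M -> sqlen ((W *m t)^~ 0) = sqlen (t^~ 0).
Proof.
by move=> WtW; rewrite !sqlen_mx trmx_mul mulmxA -(mulmxA _ W^T) WtW mulmx1.
Qed.

Lemma isometry_inj (R : realType) n m (W : 'M[R]_(n, m)) (t : 'cV[R]_m) :
  W^T *m W = 1%:M -> W *m t = 0 -> t = 0.
Proof. by move=> WtW Wt; rewrite -(mul1mx t) -WtW -mulmxA Wt mulmx0. Qed.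

Lemma separating_card (R : realType) n r (x : 'I_n -> 'rV[R]_r) m (W : 'M[R]_(n, m)) :
  injective x -> W^T *m W = 1%:M -> separating x W n.
Proof.
move=> x_inj WtW t t_neq0; rewrite ltNge; apply/negP => /moments_vanish.
move=> /(vanish_eq0 x_inj) Wt0; move/eqP: t_neq0; apply.
by apply: (isometry_inj WtW); apply/colP => i; rewrite Wt0 mxE.
Qed.

(** The moments of degree <= L define a positive definite form on the column space of W,
hence one bounded below by a multiple of |z|^2.  The damping factors move z out of this
space, but only by O(a), which does not spoil the bound when a is small. *)
Lemma gauss_ge_small (R : realType) n r (x : 'I_n -> 'rV[R]_r) m (W : 'M[R]_(n, m)) L :
  W^T *m W = 1%:M -> separating x W L.+1 ->
  exists2 c : R, 0 < c & exists2 a0 : R, 0 < a0 <= 1 &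
    forall a (t : 'cV_m), 0 <= a <= a0 ->
      c * a ^+ L * sqlen (t^~ 0) <= quad (gauss x a) ((W *m t)^~ 0).
Proof.
move=> WtW Wsep.
pose X i j : R := \sum_(k < L.+1) dot (x i) (x j) ^+ k.
have Xsym i j : X i j = X j i by apply: eq_bigr => k _; rewrite dotC.
have psdX : psd X by move=> z; rewrite -momentsE; apply: moments_ge0.
pose A : 'M[R]_m := W^T *m (\matrix_(i, j) X i j) *m W.
have qA (t : 'cV_m) : (t^T *m A *m t) 0 0 = quad X ((W *m t)^~ 0).
  rewrite /A !mulmxA -trmx_mul -!mulmxA mulmxA -bilin_mx.
  by apply: eq_bilin => i j; rewrite mxE.
have Asym : A^T = A.
  rewrite /A !trmx_mul trmxK mulmxA; congr (_ *m _ *m _).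
  by apply/matrixP => i j; rewrite !mxE Xsym.
have [|c1 c1_gt0 Ac1] := pd_ge_sqlen Asym.
  by move=> t t0; rewrite qA -momentsE; apply: Wsep.
pose C := \sum_i \sum_j `|X i j|.
have C0 : 0 <= C by apply: sumr_ge0 => i _; apply: sumr_ge0 => j _.
pose rho := \sum_i dot (x i) (x i) ^+ 2.
have rho0 : 0 <= rho by apply: sumr_ge0 => i _; apply: sqr_ge0.
have Crho : 0 <= C * rho by rewrite mulr_ge0.
have dot_ge0 i : 0 <= dot (x i) (x i).
  by apply: sumr_ge0 => k _; rewrite -expr2 sqr_ge0.
exists (c1 / 4 / L`!%:R); first by rewrite !divr_gt0 ?ltr0n ?fact_gt0.
(* Chosen so that the O(a^2) loss 2 * C * a^2 * rho is at most half of c1. *)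
pose a1 := c1 / (4 * (C * rho) + 1).
have a1_gt0 : 0 < a1 by rewrite divr_gt0//; lra.
exists (Num.min a1 1); first by rewrite lt_min a1_gt0 ltr01 ge_min lexx orbT.
move=> a t /andP[a_ge0]; rewrite le_min => /andP[aa1 a_le1].
set z := (W *m t)^~ 0.
apply: le_trans (gauss_ge_moments x L z _); last by rewrite a_ge0.
rewrite -/(moments _ _ _) momentsE -/X.
rewrite (_ : c1 / 4 / _ * _ * _ = a ^+ L / L`!%:R * (c1 / 4 * sqlen (t^~ 0))); last by ring.
apply: ler_wpM2l; first by rewrite divr_ge0 ?exprn_ge0.
set w := fun i => z i * damp x a i.
have zw : quad X z <= 2 * quad X w + 2 * quad X (fun i => z i - w i).
  (* z is the damped vector w plus a correction of size O(a). *)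
  rewrite [in leLHS](_ : z = fun i => w i + (z i - w i)); first exact: quadD_le.
  by apply/funext => i; rewrite addrC subrK.
have lenzw : sqlen (fun i => z i - w i) <= a ^+ 2 * rho * sqlen z.
  rewrite mulrC /sqlen mulr_suml; apply: ler_sum => i _.
  rewrite (_ : z i - w i = z i * (1 - damp x a i)); last by rewrite /w; ring.
  rewrite exprMn; apply: ler_wpM2l; first exact: sqr_ge0.
  apply: (@le_trans _ _ ((a * dot (x i) (x i)) ^+ 2)).
    rewrite ler_sqr ?nnegrE ?mulr_ge0//; last first.
      by rewrite subr_ge0 -expR0 ler_expR oppr_le0 mulr_ge0.
    by have := expR_ge1Dx (- (a * dot (x i) (x i))); rewrite -/(damp x a i); lra.
  rewrite exprMn; apply: ler_wpM2l; first exact: sqr_ge0.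
  by rewrite /rho (bigD1 i)//= lerDl; apply: sumr_ge0 => j _; apply: sqr_ge0.
have qzw : quad X (fun i => z i - w i) <= C * (a ^+ 2 * rho * sqlen z).
  by apply: le_trans (quad_ub _ _) _; apply: ler_wpM2l.
have := Ac1 t; rewrite qA -/z => Hc1.
have zt : sqlen z = sqlen (t^~ 0) := isometry_sqlen t WtW.
have T0 : 0 <= sqlen (t^~ 0) := sqlen_ge0 _.
have ha : 4 * (C * rho) * a ^+ 2 <= c1.
  apply: (@le_trans _ _ ((4 * (C * rho) + 1) * a)).
    apply: ler_pM; rewrite ?sqr_ge0//; [lra|lra|].
    by rewrite expr2 ler_piMl.
  by rewrite mulrC -ler_pdivlMr//; lra.
have := ler_wpM2r T0 ha; move: zw qzw Hc1; rewrite zt.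
set T := sqlen _; set S := quad X w; set S' := quad X _; set U := quad X _.
by move=> *; lra.
Qed.

Lemma psd_hadamard_gauss (R : realType) n r (x : 'I_n -> 'rV[R]_r)
    (A : 'I_n -> 'I_n -> R) (a : R) :
  psd A -> 0 <= a -> psd (fun i j => A i j * gauss x a i j).
Proof.
move=> psdA a0 z; have := hadamard_gauss_ge x 0 z psdA a0.
by rewrite big_nil.
Qed.

Lemma gaussD (R : realType) n r (x : 'I_n -> 'rV[R]_r) (a b : R) i j :
  gauss x (a + b) i j = gauss x a i j * gauss x b i j.
Proof. by rewrite /gauss -expRD; congr expR; ring. Qed.

Lemma quad_id (R : realType) n (z : 'I_n -> R) :
  quad (fun i j => (i == j)%:R) z = sqlen z.
Proof.
apply: eq_bigr => i _; rewrite (bigD1 i)//= eqxx big1 => [|j ji].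
  by rewrite addr0 mulr1 expr2.
by rewrite eq_sym (negPf ji) mulr0 mul0r.
Qed.

(** If G a0 - c I is positive semidefinite, so is its entrywise product with G (a - a0),
which is G a - c I since G (a - a0) has unit diagonal. *)
Lemma gauss_ge_mono (R : realType) n r (x : 'I_n -> 'rV[R]_r) (a0 a c : R) :
  (forall z, c * sqlen z <= quad (gauss x a0) z) -> a0 <= a ->
  forall z, c * sqlen z <= quad (gauss x a) z.
Proof.
move=> h a0a z.
pose A i j := gauss x a0 i j + - c * (i == j)%:R.
have psdA : psd A.
  move=> w; rewrite /quad bilinD bilinZ -!/(quad _ _) quad_id.
  by rewrite mulNr subr_ge0.
have := psd_hadamard_gauss x psdA (a := a - a0); rewrite subr_ge0 => /(_ a0a z).
rewrite /quad (@eq_bilin _ _ _ (fun i j => gauss x a i j + - c * (i == j)%:R)).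
  by rewrite bilinD bilinZ -!/(quad _ _) quad_id mulNr subr_ge0.
move=> i j; rewrite /A mulrDl -gaussD (addrC a0) subrK; congr (_ + _).
have [->|_] := eqVneq i j; last by rewrite !mulr0 mul0r.
by rewrite /gauss sqdistxx mulr0 oppr0 expR0; ring.
Qed.

(** Small a is [gauss_ge_small].  For larger a the same lemma applied to the whole of R^n
makes one Gram matrix positive definite, and [gauss_ge_mono] propagates the bound. *)
Lemma gauss_ge (R : realType) n r (x : 'I_n -> 'rV[R]_r) m (W : 'M[R]_(n, m)) L :
  (0 < n)%N -> injective x -> W^T *m W = 1%:M -> separating x W L.+1 ->
  exists2 c : R, 0 < c & forall a (t : 'cV_m), 0 <= a ->
      c * Num.min a 1 ^+ L * sqlen (t^~ 0) <= quad (gauss x a) ((W *m t)^~ 0).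
Proof.
move=> n_gt0 x_inj WtW Wsep.
have [c c_gt0 [a0 /andP[a0_gt0 a0_le1] hc]] := gauss_ge_small WtW Wsep.
have [||c' c'_gt0 [a0' /andP[a0'_gt0 a0'_le1] hc']] :=
  @gauss_ge_small _ _ _ x n 1%:M n.-1.
- by rewrite trmx1 mul1mx.
- rewrite prednK//; apply: separating_card => //; by rewrite trmx1 mul1mx.
pose b := Num.min a0 a0'.
have b_gt0 : 0 < b by rewrite lt_min a0_gt0.
pose d := c' * b ^+ n.-1.
have d_gt0 : 0 < d by rewrite mulr_gt0// exprn_gt0.
have gauss_b z : d * sqlen z <= quad (gauss x b) z.
  pose t : 'cV[R]_n := \col_i z i.
  have zt : t^~ 0 = z by apply/funext => i; rewrite mxE.
  have := hc' b t; rewrite mul1mx zt => -> //.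
  by rewrite (ltW b_gt0) ge_min lexx orbT.
exists (Num.min c d); first by rewrite lt_min c_gt0.
move=> a t a_ge0; have T0 := sqlen_ge0 (t^~ 0).
have m_ge0 : 0 <= Num.min a 1 by rewrite le_min a_ge0 ler01.
have [ab|/ltW ba] := lerP a b.
  have aa0 : a <= a0 by apply: le_trans ab _; rewrite ge_min lexx.
  apply: le_trans (hc a t _); last by rewrite a_ge0.
  rewrite ler_wpM2r//; apply: ler_pM; rewrite ?exprn_ge0//.
  - by rewrite le_min !ltW.
  - by rewrite ge_min lexx.
  - by rewrite lerXn2r ?nnegrE// ge_min lexx.
apply: le_trans (gauss_ge_mono gauss_b ba _); rewrite isometry_sqlen//.
rewrite ler_wpM2r// -[leRHS]mulr1; apply: ler_pM; rewrite ?exprn_ge0//.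
- by rewrite le_min !ltW.
- by rewrite ge_min lexx orbT.
- by rewrite exprn_ile1// ge_min lexx orbT.
Qed.

(** Take L + 1 to be the least N such that polynomials of degree < N separate the column
space of W; minimality provides the vector with vanishing moments. *)
Lemma flat_limit_exponent (R : realType) n r (x : 'I_n -> 'rV[R]_r) m (W : 'M[R]_(n, m)) :
  (0 < m)%N -> injective x -> W^T *m W = 1%:M ->
  exists L, separating x W L.+1 /\
    exists2 t : 'cV_m, t != 0 & vanish x L ((W *m t)^~ 0).
Proof.
move=> m_gt0 x_inj WtW.
pose P N := `[< separating x W N >].
have exP : exists N, P N by exists n; apply/asboolP; apply: separating_card.
case: (ex_minnP exP) => -[|L] /asboolP Lsep Lmin.
  have := Lsep (const_mx 1); rewrite /moments big_ord0 ltxx.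
  suff /[swap]/[apply] : (const_mx 1 : 'cV[R]_m) != 0 by [].
  apply/eqP => /matrixP/(_ (Ordinal m_gt0) 0); rewrite !mxE => /eqP.
  by rewrite oner_eq0.
exists L; split=> //.
have /existsNP[t /not_implyP[t0 /negP ht]] : ~ separating x W L.
  by move/asboolP/Lmin; rewrite ltnn.
by exists t => //; apply: moments_vanish; rewrite leNgt.
Qed.

(** * Gaussian scale mixtures *)

Definition gaussian_mixture (R : realType) (K : R -> R) : Prop :=
  exists w phi : R -> R,
    [/\ (@lebesgue_measure R).-integrable `]0, +oo[ (EFin \o w),
        measurable_fun (`]0, +oo[ : set R) phi,
        forall s, 0 < s -> 0 < w s /\ 0 < phi s
      & forall t, 0 <= t ->
          K t = \int[lebesgue_measure]_(s in `]0, +oo[) (w s * expR (- (phi s * t ^+ 2)))].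

Lemma Rintegral_sum d (T : measurableType d) (R : realType)
    (mu : {measure set T -> \bar R}) (D : set T) (I : Type) (s : seq I) (f : I -> T -> R) :
  measurable D -> (forall i, mu.-integrable D (EFin \o f i)) ->
  \int[mu]_(x in D) (\sum_(i <- s) f i x) = \sum_(i <- s) \int[mu]_(x in D) f i x.
Proof.
move=> mD intf; elim: s => [|i s IH].
  rewrite big_nil; under eq_Rintegral do rewrite big_nil.
  by rewrite Rintegral_cst// mul0r.
rewrite big_cons -IH -RintegralD//.
  by apply: eq_Rintegral => x _; rewrite big_cons.
rewrite (_ : _ \o _ = (fun x => \sum_(i <- s) (f i x)%:E)%E).
  by apply: integrable_sum => // j _; apply: intf.
by apply/funext => x /=; rewrite sumEFin.
Qed.

Lemma Rintegral_gt0 (R : realType) (f : R -> R) :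
  (@lebesgue_measure R).-integrable `]0, +oo[ (EFin \o f) ->
  (forall s, 0 < s -> 0 < f s) ->
  0 < \int[lebesgue_measure]_(s in `]0, +oo[) f s.
Proof.
move=> intf f_gt0; rewrite lt_def Rintegral_ge0 ?andbT; last first.
  by move=> s /=; rewrite in_itv/= andbT => /f_gt0/ltW.
apply/eqP => int0.
case/integrableP: (intf) => mf _.
have : (\int[lebesgue_measure]_(s in `]0%R, +oo[) `|(EFin \o f) s|)%E = 0%E.
  rewrite (_ : 0%E = (\int[@lebesgue_measure R]_(s in `]0%R, +oo[) f s)%R%:E); last first.
    by rewrite int0.
  rewrite /Rintegral fineK; last exact: (integrable_fin_num _ intf).
  apply: eq_integral => s; rewrite inE/= in_itv/= andbT => /f_gt0 s0.
  by rewrite gtr0_norm.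
move/(ae_eq_integral_abs _ _ mf) => [//|N [mN N0 DN]].
have : ((@lebesgue_measure R) `]0%R, +oo[ <= lebesgue_measure N)%E.
  apply: le_measure; rewrite ?inE//; apply: subset_trans DN => s Ds /= /(_ Ds).
  move: Ds; rewrite /= in_itv/= andbT => /f_gt0 + /eqP.
  by rewrite eqe => /lt0r_neq0/negPf ->.
by rewrite N0 lebesgue_measure_itv/= ltry oppr0 adde0.
Qed.

Lemma integrable_damped d (T : measurableType d) (R : realType)
    (mu : {measure set T -> \bar R}) (D : set T) (w g : T -> R) :
  measurable D -> mu.-integrable D (EFin \o w) -> measurable_fun D g ->
  (forall s, D s -> `|g s| <= 1) ->
  mu.-integrable D (EFin \o (fun s => w s * g s)).
Proof.
move=> mD intw mg g1.
have mw : measurable_fun D w by case/integrableP: intw => /measurable_EFinP.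
apply: le_integrable intw => //.
  by apply/measurable_EFinP; apply: measurable_funM.
by move=> s Ds /=; rewrite lee_fin normrM ler_piMr// g1.
Qed.

Lemma corr_mxE (R : realType) n r (K : R -> R) (x : 'I_n -> 'rV[R]_r) theta (w phi : R -> R) :
  (forall t, 0 <= t ->
    K t = \int[lebesgue_measure]_(s in `]0, +oo[) (w s * expR (- (phi s * t ^+ 2)))) ->
  0 < theta -> forall i j, corr_mx K x theta i j =
  \int[lebesgue_measure]_(s in `]0, +oo[) (w s * gauss x (phi s / theta ^+ 2) i j).
Proof.
move=> KE theta0 i j; rewrite mxE KE ?divr_ge0 ?sqrtr_ge0 ?ltW//.
apply: eq_Rintegral => s _; congr (_ * expR (- _)).
rewrite expr_div_n /euclidean_norm sqr_sqrtr; last first.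
  by apply: sumr_ge0 => k _; apply: sqr_ge0.
rewrite -mulrA [_^-1 * _]mulrC; congr (_ * (_ / _)).
by apply: eq_bigr => k _; rewrite !mxE.
Qed.

Lemma measurable_gauss (R : realType) n r (x : 'I_n -> 'rV[R]_r) (D : set R) (f : R -> R) i j :
  measurable_fun D f -> measurable_fun D (fun s => gauss x (f s) i j).
Proof.
move=> mf; apply: measurableT_comp => //; apply: measurableT_comp => //.
exact: measurable_funM.
Qed.

Lemma gauss_le1 (R : realType) n r (x : 'I_n -> 'rV[R]_r) (a : R) i j :
  0 <= a -> `|gauss x a i j| <= 1.
Proof.
move=> a0; rewrite ger0_norm ?expR_ge0// -expR0 ler_expR oppr_le0.
by rewrite mulr_ge0// sqdist_ge0.
Qed.

Lemma mixture_quad (R : realType) n r (K : R -> R) (x : 'I_n -> 'rV[R]_r) (theta : R)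
    (w phi : R -> R) z :
  (@lebesgue_measure R).-integrable `]0, +oo[ (EFin \o w) ->
  measurable_fun (`]0, +oo[ : set R) phi ->
  (forall s, 0 < s -> 0 < w s /\ 0 < phi s) ->
  (forall t, 0 <= t ->
    K t = \int[lebesgue_measure]_(s in `]0, +oo[) (w s * expR (- (phi s * t ^+ 2)))) ->
  0 < theta ->
  (@lebesgue_measure R).-integrable `]0, +oo[
     (EFin \o (fun s => w s * quad (gauss x (phi s / theta ^+ 2)) z)) /\
  quad (corr_mx K x theta) z =
  \int[lebesgue_measure]_(s in `]0, +oo[) (w s * quad (gauss x (phi s / theta ^+ 2)) z).
Proof.
move=> intw mphi pos KE theta0.
have D_gt0 s : `]0, +oo[%classic s -> 0 < s by rewrite /= in_itv/= andbT.
pose f i j s := z i * z j * (w s * gauss x (phi s / theta ^+ 2) i j).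
have intg i j : (@lebesgue_measure R).-integrable `]0, +oo[
    (EFin \o (fun s => w s * gauss x (phi s / theta ^+ 2) i j)).
  apply: integrable_damped => //.
    by apply: measurable_gauss; apply: measurable_funM.
  move=> s /D_gt0/pos[_ phi0]; apply: gauss_le1.
  by rewrite divr_ge0 ?sqr_ge0// ltW.
have intf i j : (@lebesgue_measure R).-integrable `]0, +oo[ (EFin \o f i j).
  rewrite (_ : _ \o _ = (fun s => (z i * z j)%:E * (w s * gauss x (phi s / theta ^+ 2) i j)%:E)%E).
    by apply: integrableZl => //; apply: intg.
  by apply/funext => s /=; rewrite EFinM.
have sumE : (fun s => w s * quad (gauss x (phi s / theta ^+ 2)) z)
    = (fun s => \sum_i \sum_j f i j s).
  apply/funext => s; rewrite /quad /bilin mulr_sumr; apply: eq_bigr => i _.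
  by rewrite mulr_sumr; apply: eq_bigr => j _; rewrite /f; ring.
have intfi i : (@lebesgue_measure R).-integrable `]0, +oo[ (EFin \o (fun s => \sum_j f i j s)).
  rewrite (_ : _ \o _ = (fun s => \sum_j (f i j s)%:E)%E).
    by apply: integrable_sum => // j _; apply: intf.
  by apply/funext => s /=; rewrite sumEFin.
rewrite sumE; split.
  rewrite (_ : _ \o _ = (fun s => \sum_i (\sum_j f i j s)%R%:E)%E).
    by apply: integrable_sum => // i _; apply: intfi.
  by apply/funext => s /=; rewrite sumEFin.
rewrite Rintegral_sum//; apply: eq_bigr => i _; rewrite Rintegral_sum//.
apply: eq_bigr => j _; rewrite /f RintegralZl//.
by rewrite (corr_mxE _ KE)//; ring.
Qed.

(** The number h is the integral of w s * min (phi s / theta^2, 1)^L.  That the same h occurs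
in the lower bound for all vectors and in the upper bound for the fixed vector t0, which
does not depend on theta, is the heart of the matter. *)
Lemma mixture_pinch (R : realType) n r (K : R -> R) (x : 'I_n -> 'rV[R]_r)
    m (W : 'M[R]_(n, m)) :
  gaussian_mixture K -> (0 < n)%N -> (0 < m)%N -> injective x -> W^T *m W = 1%:M ->
  exists2 t0 : 'cV_m, t0 != 0 & exists c C : R, [/\ 0 < c, 0 < C &
    forall theta, 0 < theta -> exists2 h, 0 < h &
      (forall t : 'cV_m, c * h * sqlen (t^~ 0) <= quad (corr_mx K x theta) ((W *m t)^~ 0)) /\
      quad (corr_mx K x theta) ((W *m t0)^~ 0) <= C * h].
Proof.
move=> [w [phi [intw mphi pos KE]]] n0 m0 x_inj WtW.
have [L [Wsep [t0 t0_neq0 van]]] := flat_limit_exponent m0 x_inj WtW.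
have [c c_gt0 hc] := gauss_ge n0 x_inj WtW Wsep.
have [C C_gt0 hC] := gauss_le_vanish van.
exists t0 => //; exists c, C; split=> // theta theta0.
have D_gt0 s : `]0, +oo[%classic s -> 0 < s by rewrite /= in_itv/= andbT.
pose g s := Num.min (phi s / theta ^+ 2) 1 ^+ L.
have phi_gt0 s : 0 < s -> 0 < phi s / theta ^+ 2.
  by move=> /pos[_ ?]; rewrite divr_gt0// exprn_gt0.
have intg : (@lebesgue_measure R).-integrable `]0, +oo[ (EFin \o (fun s => w s * g s)).
  apply: integrable_damped => //.
    apply: measurable_funX; apply: measurable_minr => //.
    exact: measurable_funM.
  move=> s /D_gt0/phi_gt0 ps; have p0 := ltW ps.
  have m_ge0 : 0 <= Num.min (phi s / theta ^+ 2) 1 by rewrite le_min p0 ler01.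
  by rewrite ger0_norm ?exprn_ge0// exprn_ile1// ge_min lexx orbT.
exists (\int[lebesgue_measure]_(s in `]0, +oo[) (w s * g s)).
  apply: Rintegral_gt0 => // s s0; have [w0 _] := pos s s0.
  by rewrite mulr_gt0// exprn_gt0// lt_min phi_gt0// ltr01.
have quadE z := mixture_quad x z intw mphi pos KE theta0.
have intZ k : (@lebesgue_measure R).-integrable `]0, +oo[ (EFin \o (fun s => k * (w s * g s))).
  rewrite (_ : _ \o _ = (fun s => k%:E * (w s * g s)%:E)%E); last first.
    by apply/funext => s /=; rewrite EFinM.
  by apply: integrableZl.
split=> [t|].
  rewrite mulrAC -RintegralZl//; have [intq ->] := quadE ((W *m t)^~ 0).
  apply: le_Rintegral => //.
  move=> s /D_gt0 s0; have [w0 _] := pos s s0.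
  rewrite mulrCA; apply: ler_wpM2l; first exact: ltW.
  by rewrite mulrAC; apply: hc; rewrite ltW// phi_gt0.
rewrite -RintegralZl//; have [intq ->] := quadE ((W *m t0)^~ 0).
apply: le_Rintegral => //.
move=> s /D_gt0 s0; have [w0 _] := pos s s0.
rewrite mulrCA; apply: ler_wpM2l; first exact: ltW.
by apply: hC; rewrite ltW// phi_gt0.
Qed.

(** * Integrals over the positive half-line *)

Lemma exprn_le_expR (R : realType) (k : nat) :
  exists2 C : R, 0 < C & forall x, 0 <= x -> (1 + x) ^+ k <= C * expR (x / 2).
Proof.
case: k => [|k].
  exists 1 => // x x0; rewrite expr0 mul1r -[leLHS]expR0 ler_expR; lra.
exists (2 ^+ k.+1 * k.+1`!%:R * expR (2^-1)).
  by rewrite !mulr_gt0 ?expR_gt0 ?ltr0n ?fact_gt0// exprn_gt0.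
move=> x x0; have y0 : 0 <= (1 + x) / 2 by lra.
have := expR_ge1Dxn k y0; set E := expR _ => hE.
have -> : 2 ^+ k.+1 * k.+1`!%:R * expR 2^-1 * expR (x / 2) = 2 ^+ k.+1 * (k.+1`!%:R * E).
  rewrite -!mulrA -expRD; congr (_ * (_ * expR _)); lra.
have -> : (1 + x) ^+ k.+1 = 2 ^+ k.+1 * ((1 + x) / 2) ^+ k.+1.
  by rewrite -exprMn; congr (_ ^+ _); lra.
apply: ler_wpM2l; first by rewrite exprn_ge0.
rewrite -ler_pdivrMl ?ltr0n ?fact_gt0// mulrC; apply: le_trans hE.
by rewrite lerDr.
Qed.

(** A common dominating function: its decay is slow enough for the variance integral when
n - p = 1, where the integrand only decays like u^(-3/2). *)
Lemma integrable_tail (R : realType) :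
  (@lebesgue_measure R).-integrable `]0, +oo[
    (EFin \o (fun u : R => (1 + u) `^ (- (3 / 2)))).
Proof.
pose F (u : R) : R := (- 2) * (1 + u) `^ (- 2^-1).
pose f (u : R) : R := (1 + u) `^ (- (3 / 2)).
have dF u : -1 < u -> is_derive (u : R^o) 1 F (f u).
  move=> u1; have u0 : 0 < 1 + u by lra.
  have h : is_derive (u : R^o) 1 (fun v : R => (1 + v) `^ (- 2^-1))
      (- 2^-1 * (1 + u) `^ (- 2^-1 - 1) * 1).
    apply: (@is_derive1_comp _ (fun y : R => y `^ (- 2^-1)) (fun v : R => 1 + v)).
      exact: is_derive1_powR.
    by rewrite -[1 in X in is_derive _ _ _ X]add0r; apply: is_deriveD.
  rewrite (_ : F = (- 2 : R) *: (fun v : R => (1 + v) `^ (- 2^-1) : R^o)); last first.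
    by apply/funext.
  apply: (is_derive_eq (is_deriveZ (- 2) h)).
  rewrite /f mulr1 /GRing.scale/= mulrA (_ : -2 * - 2^-1 = 1); last by lra.
  by rewrite mul1r; congr (_ `^ _); lra.
have cf u : -1 < u -> {for u, continuous f}.
  move=> u1; have u0 : 0 < 1 + u by lra.
  have h : is_derive (u : R^o) 1 f (- (3/2) * (1 + u) `^ (- (3 / 2) - 1) * 1).
    apply: (@is_derive1_comp _ (fun y : R => y `^ (- (3/2))) (fun v : R => 1 + v)).
      exact: is_derive1_powR.
    by rewrite -[1 in X in is_derive _ _ _ X]add0r; apply: is_deriveD.
  by apply: differentiable_continuous; apply/derivable1_diffP; case: h.
have cF u : -1 < u -> {for u, continuous F}.
  move=> u1; have h := dF u u1.
  by apply: differentiable_continuous; apply/derivable1_diffP; case: h.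
have f0 u : 0 <= f u by apply: powR_ge0.
have mf : measurable_fun (setT : set R) f.
  apply: (measurableT_comp (measurable_powR (- (3 / 2)))).
  exact: measurable_funD.
have intE : (\int[@lebesgue_measure R]_(x in `[0%R, +oo[) (f x)%:E = 0%:E - (F 0)%:E)%E.
  apply: ge0_continuous_FTC2y => //.
  - apply: continuous_in_subspaceT => u; rewrite inE/= in_itv/= andbT => u0.
    by apply: cf; lra.
  - rewrite (_ : 0 = -2 * 0 :> R); last by rewrite mulr0.
    apply: cvgM; first exact: cvg_cst.
    apply/cvgr0Pnorm_lt => e e0; near=> u.
    have u0 : 0 < 1 + u by near: u; exists 0; split => // ? ?; lra.
    rewrite ger0_norm ?powR_ge0// powRN powR12_sqrt ?ltW//.
    rewrite invf_plt ?posrE ?sqrtr_gt0// -[ltLHS]gtr0_norm ?invr_gt0//.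
    rewrite -sqrtr_sqr ltr_sqrt//; apply: (@lt_le_trans _ _ u); last by lra.
    by near: u; apply: nbhs_pinfty_gt; rewrite num_real.
  - by move=> u u0; have h := dF u; case: (h _) => //; lra.
  - by apply: cvg_at_right_filter; apply: cF; lra.
  - move=> u; rewrite in_itv/= andbT => u0; rewrite derive1E.
    by have h := dF u; case: (h _) => //; lra.
apply/integrableP; split.
  by apply/measurable_EFinP; apply: measurable_funTS.
under eq_integral do rewrite /= ger0_norm ?powR_ge0//.
rewrite integral_itv_obnd_cbnd; last first.
  by apply/measurable_EFinP; apply: measurable_funTS.
by rewrite intE ltry.
Unshelve. all: by end_near.
Qed.

Lemma integrable_le_tail (R : realType) (f : R -> R) (C : R) :
  measurable_fun (`]0, +oo[ : set R) f ->
  (forall u, 0 < u -> `|f u| <= C * (1 + u) `^ (- (3 / 2))) ->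
  (@lebesgue_measure R).-integrable `]0, +oo[ (EFin \o f).
Proof.
move=> mf fC.
have intC : (@lebesgue_measure R).-integrable `]0, +oo[
    (EFin \o (fun u : R => C * (1 + u) `^ (- (3 / 2)))).
  rewrite (_ : _ \o _ = (fun u => C%:E * ((1 + u) `^ (- (3 / 2)))%:E)%E); last first.
    by apply/funext => u /=; rewrite EFinM.
  by apply: integrableZl => //; apply: integrable_tail.
apply: le_integrable intC => //; first exact/measurable_EFinP.
move=> u /=; rewrite in_itv/= andbT => u0; rewrite lee_fin.
apply: le_trans (fC u u0) (ler_norm _).
Qed.

(** Lets a change of variables on compact intervals pass to the half-line. *)
Lemma integral_exhaust (R : realType) (f : R -> R) (a b : nat -> R) :
  measurable_fun (`]0, +oo[ : set R) f -> (forall u, 0 < u -> 0 <= f u) ->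
  (forall i, 0 < a i) -> nonincreasing_seq a -> nondecreasing_seq b ->
  (forall u, 0 < u -> exists i, a i <= u <= b i) ->
  (\int[lebesgue_measure]_(u in `[a i, b i]) (f u)%:E)%E @[i --> \oo]
   --> (\int[lebesgue_measure]_(u in `]0%R, +oo[) (f u)%:E)%E.
Proof.
move=> mf f0 a0 nda ndb ex.
have sub i : `[a i, b i]%classic `<=` `]0, +oo[%classic.
  by move=> u /=; rewrite !in_itv/= andbT => /andP[+ _]; apply: lt_le_trans.
rewrite (_ : `]0, +oo[%classic = \bigcup_i `[a i, b i]%classic); last first.
  apply/seteqP; split=> u; last by move=> [i _]; apply: sub.
  by rewrite /= in_itv/= andbT => /ex[i abi]; exists i => //=; rewrite in_itv.
apply: ge0_nondecreasing_set_cvg_integral => //.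
- move=> i j ij; rewrite subsetEset => u /=; rewrite !in_itv/= => /andP[h1 h2].
  by rewrite (le_trans (nda _ _ ij) h1) (le_trans h2 (ndb _ _ ij)).
- move=> i; apply/measurable_EFinP; apply: measurable_funS (sub i) mf => //.
- by move=> i u /sub /=; rewrite in_itv/= andbT lee_fin => /f0.
Qed.

Lemma exhaust_bound (R : realType) (c u : R) : 0 < c -> 0 < u ->
  exists i : nat, c / i.+1%:R <= u <= c * i.+1%:R.
Proof.
move=> c0 u0; exists (Num.bound (c / u + u / c)).
set N := Num.bound _; have p1 : 0 < c / u by rewrite divr_gt0.
have p2 : 0 < u / c by rewrite divr_gt0.
have hN : c / u + u / c <= N.+1%:R.
  apply: ltW; apply: (@lt_le_trans _ _ N%:R); last by rewrite ler_nat.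
  by apply: archi_boundP; lra.
apply/andP; split.
  rewrite ler_pdivrMr ?ltr0n// mulrC -ler_pdivrMr//; lra.
by rewrite mulrC -ler_pdivrMr//; lra.
Qed.

Lemma integral_scale (R : realType) (f : R -> R) (c : R) :
  {in `]0, +oo[, continuous f} -> (forall u, 0 < u -> 0 <= f u) -> 0 < c ->
  (\int[lebesgue_measure]_(u in `]0%R, +oo[) (f (c * u) * c)%:E
   = \int[lebesgue_measure]_(u in `]0%R, +oo[) (f u)%:E)%E.
Proof.
move=> cf f0 c0.
have mf : measurable_fun (`]0, +oo[ : set R) f.
  apply: open_continuous_measurable_fun; first exact: interval_open.
  by move=> u; rewrite inE; apply: cf.
have mg : measurable_fun (`]0, +oo[ : set R) (fun u => f (c * u) * c).
  apply: measurable_funM => //.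
  apply: (@measurable_comp _ _ _ _ _ _ (`]0, +oo[ : set R)) mf _ => //.
  by move=> _ [u /=] /[swap] <-; rewrite !in_itv/= !andbT => ?; rewrite mulr_gt0.
pose a i : R := 1 / i.+1%:R. pose b i : R := i.+1%:R.
have h1 : (\int[lebesgue_measure]_(u in `[a i, b i]) (f (c * u) * c)%:E)%E @[i --> \oo]
   --> (\int[lebesgue_measure]_(u in `]0%R, +oo[) (f (c * u) * c)%:E)%E.
  apply: integral_exhaust => //.
  - by move=> u u0; apply: mulr_ge0; [apply: f0; rewrite mulr_gt0|exact: ltW].
  - by move=> i; rewrite /a divr_gt0.
  - by move=> i j ij; rewrite /a !div1r lef_pV2 ?posrE// ler_nat.
  - by move=> i j ij; rewrite /b ler_nat.
  - move=> u /(exhaust_bound ltr01)[i hi]; exists i.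
    by move: hi; rewrite [X in _ <= _ <= X]mul1r.
have h2 : (\int[lebesgue_measure]_(u in `[(c * a i)%R, (c * b i)%R]) (f u)%:E)%E @[i --> \oo]
   --> (\int[lebesgue_measure]_(u in `]0%R, +oo[) (f u)%:E)%E.
  apply: integral_exhaust => //.
  - by move=> i; rewrite /a mulr_gt0// divr_gt0.
  - by move=> i j ij; rewrite ler_pM2l// /a !div1r lef_pV2 ?posrE// ler_nat.
  - by move=> i j ij; rewrite ler_pM2l// /b ler_nat.
  - by move=> u /(exhaust_bound c0)[i hi]; exists i; rewrite /a div1r.
rewrite -(cvg_lim (@ereal_hausdorff R) h1) -(cvg_lim (@ereal_hausdorff R) h2).
apply: congr_lim; apply/funext => i.
have dc : ((fun u : R^o => c * u : R^o)^`())%classic = cst c.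
  by apply/funext => u; rewrite derive1E deriveM// derive_cst scaler0 addr0 derive_id; apply: mulr1.
symmetry; rewrite (@integration_by_substitution_increasing _ (fun u => c * u) f).
- by apply: eq_integral => u _; rewrite dc.
- by rewrite /a /b div1r (@le_trans _ _ 1)// ?invf_le1// ler1n.
- by move=> u v _ _; rewrite ltr_pM2l.
- by rewrite dc => u _; apply: cvg_cst.
- by rewrite dc; apply: is_cvg_cst.
- by rewrite dc; apply: is_cvg_cst.
- split.
  + by move=> u _; apply: derivableM.
  + by apply: cvg_at_right_filter; apply: cvgM; [apply: cvg_cst|apply: cvg_id].
  + by apply: cvg_at_left_filter; apply: cvgM; [apply: cvg_cst|apply: cvg_id].
- apply: continuous_in_subspaceT => u; rewrite inE/= in_itv/= => /andP[au _].
  apply: cf; rewrite in_itv/= andbT; apply: lt_le_trans au.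
  by rewrite mulr_gt0// divr_gt0.
Qed.

Lemma fine_mulr_EFin (R : realType) (y : \bar R) (c : R) : 0 < c ->
  fine (y * c%:E)%E = c * fine y.
Proof.
move=> c0; case: y => [y| |] /=; first by rewrite mulrC.
  by rewrite gt0_mulye ?lte_fin// mulr0.
by rewrite gt0_mulNye ?lte_fin// mulr0.
Qed.

Lemma Rintegral_scale (R : realType) (f : R -> R) (c : R) :
  {in `]0, +oo[, continuous f} -> (forall u, 0 < u -> 0 <= f u) -> 0 < c ->
  c * \int[lebesgue_measure]_(u in `]0, +oo[) f (c * u) =
  \int[lebesgue_measure]_(u in `]0, +oo[) f u.
Proof.
move=> cf f0 c0; rewrite /Rintegral -(integral_scale cf f0 c0) -fine_mulr_EFin//.
congr fine; rewrite -ge0_integralZr//.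
- apply/measurable_EFinP.
  apply: (@measurable_comp _ _ _ _ _ _ (`]0, +oo[ : set R)) _ _ => //.
  + by move=> _ [u /=] /[swap] <-; rewrite !in_itv/= !andbT => ?; rewrite mulr_gt0.
  + apply: open_continuous_measurable_fun; first exact: interval_open.
    by move=> u; rewrite inE; apply: cf.
- by move=> u; rewrite /= in_itv/= andbT lee_fin => u0; rewrite f0// mulr_gt0.
- by rewrite lee_fin ltW.
Qed.

Lemma continuous_powR_gt0 (R : realType) (p u : R) : 0 < u ->
  {for u, continuous (fun v : R => v `^ p)}.
Proof.
move=> u0; have h := is_derive1_powR p u0.
by apply: differentiable_continuous; apply/derivable1_diffP; case: h.
Qed.

Lemma continuous_expR_fun (R : realType) (f : R -> R) (u : R) :
  {for u, continuous f} -> {for u, continuous (fun v : R => expR (f v))}.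
Proof. by move=> cf; apply: (continuous_comp cf); exact: continuous_expR. Qed.

Lemma measurable_powR_fun d (T : measurableType d) (R : realType) (D : set T) (f : T -> R) (p : R) :
  measurable_fun D f -> measurable_fun D (fun u => f u `^ p).
Proof. by move=> mf; apply: (measurableT_comp (measurable_powR p)). Qed.

Lemma measurable_expR_fun d (T : measurableType d) (R : realType) (D : set T) (f : T -> R) :
  measurable_fun D f -> measurable_fun D (fun u => expR (f u)).
Proof. by move=> mf; apply: measurableT_comp. Qed.

Lemma integrable_le_sqr (R : realType) (f : R -> R) (C : R) : 0 <= C ->
  measurable_fun (`]0, +oo[ : set R) f ->
  (forall u, 0 < u -> `|f u| * (1 + u) ^+ 2 <= C) ->
  (@lebesgue_measure R).-integrable `]0, +oo[ (EFin \o f).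
Proof.
move=> C0 mf fC; apply: (integrable_le_tail (C := C)) => // u u0.
have u1 : 1 <= 1 + u by lra.
have p0 : 0 < (1 + u) ^+ 2 by rewrite exprn_gt0//; lra.
apply: (@le_trans _ _ (C * ((1 + u) ^+ 2)^-1)); first by rewrite ler_pdivlMr// fC.
apply: ler_wpM2l => //; rewrite -powR_mulrn; last lra.
by rewrite -powRN ler_powR//; lra.
Qed.

Lemma integrable_expR_powR (R : realType) (p : R) : 0 < p ->
  (@lebesgue_measure R).-integrable `]0, +oo[
    (EFin \o (fun u : R => expR (- (u `^ p)))).
Proof.
(* With x = u^p, a power of 1 + u is at most a power of 1 + x. *)
move=> p0; pose k := Num.bound p^-1.
have pk : p^-1 <= k%:R by apply/ltW/archi_boundP; rewrite invr_ge0 ltW.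
have [C C0 hC] := exprn_le_expR R (k * 2).
apply: (integrable_le_sqr (C := 4 * C)); first lra.
  apply: measurable_expR_fun; apply: measurableT_comp => //.
  exact: measurable_powR_fun.
move=> u u0; set x := u `^ p; have x0 : 0 <= x by exact: powR_ge0.
have ux : u <= (1 + x) ^+ k.
  have -> : u = x `^ p^-1 by rewrite /x -powRrM divff ?powRr1 ?ltW ?lt0r_neq0.
  apply: (@le_trans _ _ ((1 + x) `^ p^-1)).
    apply: ge0_ler_powR; rewrite ?nnegrE ?invr_ge0 ?(ltW p0)//; lra.
  rewrite -powR_mulrn; last lra.
  by apply: ler_powR => //; lra.
have u1 : (1 + u) ^+ 2 <= 4 * (1 + x) ^+ (k * 2).
  have x1 : 1 <= (1 + x) ^+ k by apply: exprn_ege1; lra.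
  rewrite exprM (_ : 4 = 2 ^+ 2 :> R); last by ring.
  by rewrite -exprMn; apply: lerXn2r; rewrite ?nnegrE; lra.
rewrite ger0_norm ?expR_ge0//.
apply: (@le_trans _ _ (expR (- x) * (4 * (C * expR (x / 2))))).
  apply: ler_wpM2l; first exact: expR_ge0.
  by apply: le_trans u1 _; apply: ler_wpM2l => //; apply: hC.
rewrite [leLHS](_ : _ = 4 * C * (expR (- x) * expR (x / 2))); last by ring.
rewrite -[leRHS]mulr1; apply: ler_wpM2l; first lra.
by rewrite -expRD -[leRHS]expR0 ler_expR; lra.
Qed.

Lemma integrable_gamma (R : realType) (nu : R) : 1 <= nu ->
  (@lebesgue_measure R).-integrable `]0, +oo[
    (EFin \o (fun u : R => u `^ (nu - 1) * expR (- u))).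
Proof.
move=> nu1; pose k := Num.bound (nu - 1).
have nuk : nu - 1 <= k%:R by apply/ltW/archi_boundP; lra.
have [C C0 hC] := exprn_le_expR R (k + 2).
apply: (integrable_le_sqr (C := C)); first lra.
  apply: measurable_funM; first exact: measurable_powR_fun.
  by apply: measurable_expR_fun; apply: measurable_funTS; exact: oppr_measurable.
move=> u u0; rewrite ger0_norm ?mulr_ge0 ?powR_ge0 ?expR_ge0//.
have unu : u `^ (nu - 1) <= (1 + u) ^+ k.
  apply: (@le_trans _ _ ((1 + u) `^ (nu - 1))).
    by apply: ge0_ler_powR; rewrite ?nnegrE; lra.
  rewrite -powR_mulrn; last lra.
  by apply: ler_powR => //; lra.
apply: (@le_trans _ _ (expR (- u) * (C * expR (u / 2)))).
  rewrite mulrAC mulrC; apply: ler_wpM2l; first exact: expR_ge0.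
  apply: le_trans (hC u (ltW u0)); rewrite exprD; apply: ler_wpM2r => //.
  by rewrite exprn_ge0//; lra.
rewrite mulrCA -[leRHS]mulr1; apply: ler_wpM2l; first lra.
by rewrite -expRD -[leRHS]expR0 ler_expR; lra.
Qed.

(** * The kernels as Gaussian scale mixtures *)

(** The weight need not have total mass 1: any positive constant can be absorbed. *)
Lemma mixture_of_weight (R : realType) (K w phi : R -> R) (c : R) :
  (@lebesgue_measure R).-integrable `]0, +oo[ (EFin \o w) ->
  measurable_fun (`]0, +oo[ : set R) phi ->
  (forall s, 0 < s -> 0 < w s /\ 0 < phi s) ->
  0 < c ->
  (forall t, 0 <= t -> c * K t =
    \int[lebesgue_measure]_(s in `]0, +oo[) (w s * expR (- (phi s * t ^+ 2)))) ->
  gaussian_mixture K.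
Proof.
move=> intw mphi pos c0 KE; exists (fun s => c^-1 * w s), phi; split=> //.
- rewrite (_ : _ \o _ = (fun s => (c^-1)%:E * (w s)%:E)%E); last first.
    by apply/funext => s /=; rewrite EFinM.
  exact: integrableZl.
- by move=> s /pos[w0 p0]; rewrite mulr_gt0// invr_gt0.
- move=> t t0; have <- : c^-1 * (c * K t) = K t by rewrite mulKf ?lt0r_neq0.
  rewrite KE// -RintegralZl//.
    by apply: eq_Rintegral => s _; rewrite mulrA.
  apply: integrable_damped => //.
    by apply: measurable_expR_fun; apply: measurableT_comp => //; apply: measurable_funM.
  move=> s /=; rewrite in_itv/= andbT => /pos[_ p0].
  rewrite ger0_norm ?expR_ge0// -[leRHS]expR0 ler_expR oppr_le0.
  by rewrite mulr_ge0 ?sqr_ge0// ltW.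
Qed.

(** Gamma integral, in the variable u = s^nu: the weight exp (- u^(1/nu)) is then bounded near
0 for every nu > 0, and (1 + t^2)^-nu comes out as a scaling factor. *)
Lemma rational_quadratic_mixture (R : realType) (nu : R) : 0 < nu ->
  gaussian_mixture (rational_quadratic nu).
Proof.
move=> nu0; have p0 : 0 < nu^-1 by rewrite invr_gt0.
have intw := integrable_expR_powR p0.
apply: (@mixture_of_weight _ _ (fun u => expR (- (u `^ nu^-1))) (fun u => u `^ nu^-1)
  (\int[lebesgue_measure]_(s in `]0, +oo[) expR (- (s `^ nu^-1)))) => //.
- exact: measurable_powR_fun.
- by move=> s s0; rewrite expR_gt0 powR_gt0.
- by apply: Rintegral_gt0 => // s _; apply: expR_gt0.
move=> t t0; set c := \int[_]_(_ in _) _.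
have t1 : 0 < 1 + t ^+ 2 by rewrite ltr_pwDl// sqr_ge0.
pose k := (1 + t ^+ 2) `^ nu; have k0 : 0 < k by apply: powR_gt0.
have kE : rational_quadratic nu t = k^-1 by rewrite /rational_quadratic powRN.
have h : k * \int[lebesgue_measure]_(u in `]0, +oo[) expR (- ((k * u) `^ nu^-1)) = c.
  apply: (@Rintegral_scale _ (fun u => expR (- (u `^ nu^-1)))) => //.
  move=> u; rewrite in_itv/= andbT => u0.
  apply: (@continuous_comp _ _ _ (fun u => - (u `^ nu^-1)) expR); last exact: continuous_expR.
  by apply: cvgN; apply: continuous_powR_gt0.
transitivity (\int[lebesgue_measure]_(u in `]0, +oo[) expR (- ((k * u) `^ nu^-1))).
  rewrite kE; clearbody c; apply: (mulfI (lt0r_neq0 k0)).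
  by rewrite h mulrCA divff ?mulr1// lt0r_neq0.
apply: eq_Rintegral => s; rewrite inE/= in_itv/= andbT => s0.
rewrite -expRD powRM ?ltW// /k -powRrM divff ?lt0r_neq0// powRr1 ?ltW//.
by congr expR; ring.
Qed.

Lemma squared_exponential_mixture (R : realType) :
  gaussian_mixture (@squared_exponential R).
Proof.
have intw := integrable_gamma (lexx (1 : R)).
apply: (@mixture_of_weight _ _ (fun u : R => u `^ (1 - 1) * expR (- u)) (fun=> 1)
  (\int[lebesgue_measure]_(u in `]0, +oo[) (u `^ (1 - 1) * expR (- u)))) => //.
- by move=> s s0; rewrite ltr01 mulr_gt0 ?powR_gt0 ?expR_gt0.
- by apply: Rintegral_gt0 => // s s0; rewrite mulr_gt0 ?powR_gt0 ?expR_gt0.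
- by move=> t _; rewrite -RintegralZr//; apply: eq_Rintegral => s _; rewrite mul1r.
Qed.

Lemma integral_itv_split (R : realType) (f : R -> R) (a b c : R) :
  measurable_fun (`[a, c] : set R) f -> (forall u, a <= u <= c -> 0 <= f u) ->
  a <= b <= c ->
  (\int[lebesgue_measure]_(u in `[a, c]) (f u)%:E =
   \int[lebesgue_measure]_(u in `[a, b]) (f u)%:E +
   \int[lebesgue_measure]_(u in `[b, c]) (f u)%:E)%E.
Proof.
move=> mf f0 /andP[ab bc].
have mfab : measurable_fun (`[a, b[ : set R) f.
  apply: measurable_funS mf => // u /=; rewrite !in_itv/= => /andP[-> ub] /=.
  by rewrite (le_trans (ltW ub)).
rewrite -(@integral_itv_bndo_bndc _ (BLeft a) b); last exact/measurable_EFinP.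
have UE : `[a, c]%classic = `[a, b[%classic `|` `[b, c]%classic.
  by rewrite -itv_bndbnd_setU// ?bnd_simp.
rewrite UE ge0_integral_setU//= -?UE.
- exact/measurable_EFinP.
- move=> u [|]; rewrite ?in_itv lee_fin => /andP[/= h1 h2]; apply: f0.
    by rewrite h1 (le_trans (ltW h2)).
  by rewrite h2 (le_trans ab).
- apply/disj_setPS => u [] /=; rewrite !in_itv/= => /andP[_ ub] /andP[bu _].
  by move: ub; rewrite ltNge bu.
Qed.

(** Substitute s = c * e^t for s > c and s = c * e^-t for s < c: the two halves of the
integral over s combine into the hyperbolic cosine of nu * t. *)
Lemma integral_bessel (R : realType) (nu c : R) : 1 <= nu -> 0 < c ->
  \int[lebesgue_measure]_(s in `]0, +oo[) (s `^ (nu - 1) * expR (- s) * expR (- (c ^+ 2 / s)))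
  = 2 * c `^ nu * besselK nu (2 * c).
Proof.
move=> nu1 c0.
pose G (s : R) : R := s `^ (nu - 1) * expR (- s) * expR (- (c ^+ 2 / s)).
(* q t dt is the pull-back of G s ds along s = c * e^t. *)
pose q (t : R) : R := c `^ nu * expR (nu * t) * expR (- (2 * c) * hcos t).
have G0 s : 0 <= G s by rewrite !mulr_ge0 ?powR_ge0 ?expR_ge0.
have q0 t : 0 <= q t by rewrite !mulr_ge0 ?powR_ge0 ?expR_ge0.
have ce0 t : 0 < c * expR t by rewrite mulr_gt0 ?expR_gt0.
have qE t : q t = G (c * expR t) * (c * expR t).
  transitivity ((c * expR t) * (c * expR t) `^ (nu - 1) *
      (expR (- (c * expR t)) * expR (- (c ^+ 2 / (c * expR t))))); last by rewrite /G; ring.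
  rewrite mulr_powRB1 -?expRD ?ltW//; last lra.
  rewrite powRM ?expR_ge0 ?ltW// -expRM (mulrC t); congr (_ * _ * expR _).
  by rewrite /hcos expRN; field; rewrite !gt_eqF ?expR_gt0.
have cG : {in `]0, +oo[, continuous G}.
  move=> s; rewrite in_itv/= andbT => s0.
  have c1 := @continuous_powR_gt0 R (nu - 1) s s0.
  have c2 : {for s, continuous (fun s : R => expR (- s))}.
    by apply: continuous_expR_fun; exact: oppr_continuous.
  have c3 : {for s, continuous (fun s : R => expR (- (c ^+ 2 / s)))}.
    apply: continuous_expR_fun; apply: cvgN; apply: cvgM; first exact: cvg_cst.
    by apply: cvgV; [rewrite gt_eqF|exact: cvg_id].
  exact: (cvgM (cvgM c1 c2) c3).
have mG : measurable_fun (`]0, +oo[ : set R) G.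
  apply: open_continuous_measurable_fun; first exact: interval_open.
  by move=> u; rewrite inE; apply: cG.
have hcosC (t : R) : hcos (- t) = hcos t by rewrite /hcos opprK addrC.
have cexpN (t : R) : {for t, continuous (fun t : R => expR (- t))}.
  by apply: continuous_expR_fun; exact: oppr_continuous.
have chcos : continuous (@hcos R).
  move=> t; apply: cvgM; last exact: cvg_cst.
  exact: (cvgD (@continuous_expR R t) (@cexpN t)).
have cq : continuous q.
  move=> t.
  have c1 : {for t, continuous (fun t : R => expR (nu * t))}.
    by apply: continuous_expR_fun; apply: cvgM; [exact: cvg_cst|exact: cvg_id].
  have c2 : {for t, continuous (fun t : R => expR (- (2 * c) * hcos t))}.
    by apply: continuous_expR_fun; apply: cvgM; [exact: cvg_cst|exact: chcos].
  by apply: (cvgM _ c2); apply: cvgM; [exact: cvg_cst|exact: c1].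
have mq : measurable_fun (setT : set R) q by apply: continuous_measurable_fun.
have mqN : measurable_fun (setT : set R) (fun t => q (- t)).
  by apply: measurableT_comp => //; apply: oppr_measurable.
have cGab a b : 0 < a -> {within `[a, b], continuous G}.
  move=> a0; apply: continuous_in_subspaceT => u; rewrite inE/= in_itv/= => /andP[au _].
  by apply: cG; rewrite in_itv/= andbT; apply: lt_le_trans au.
have dF : ((fun t : R^o => c * expR t : R^o)^`())%classic = fun t => c * expR t.
  apply/funext => t; rewrite derive1E.
  have h := is_deriveZ c (is_derive_expR t); by case: h.
have dFN : ((fun t : R^o => c * expR (- t) : R^o)^`())%classic = fun t => - (c * expR (- t)).
  apply/funext => t; rewrite derive1E.
  have h : is_derive (t : R^o) 1 (fun t : R => expR (- t)) (expR (- t) * -1).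
    by apply: (@is_derive1_comp _ expR -%R); apply: is_deriveN.
  by have := is_deriveZ c h; case=> _; rewrite mulrN1 scalerN.
have cF : continuous (fun t : R => c * expR t).
  by move=> t; apply: cvgM; [exact: cvg_cst|exact: continuous_expR].
have cFN : continuous (fun t : R => c * expR (- t)).
  by move=> t; apply: cvgM; [exact: cvg_cst|exact: cexpN].
have dexpN (t : R) : derivable (fun t : R => expR (- t)) (t : R^o) 1.
  have h : is_derive (t : R^o) 1 (fun t : R => expR (- t)) (expR (- t) * -1).
    by apply: (@is_derive1_comp _ expR -%R); apply: is_deriveN.
  by case: h.
have step i : (\int[lebesgue_measure]_(t in `[0%R, i%:R]) (q t + q (- t))%:E =
   \int[lebesgue_measure]_(s in `[(c * expR (- i%:R))%R, (c * expR i%:R)%R]) (G s)%:E)%E.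
  under eq_integral do rewrite EFinD.
  rewrite ge0_integralD//=; first last.
  - by apply/measurable_EFinP; apply: measurable_funTS.
  - by move=> t _; rewrite lee_fin.
  - by apply/measurable_EFinP; apply: measurable_funTS.
  - by move=> t _; rewrite lee_fin.
  rewrite (@integral_itv_split _ G _ c).
  - rewrite addeC; congr (_ + _)%E.
    + have e0 : c * expR 0 = c by rewrite expR0 mulr1.
      rewrite -{1}e0.
      rewrite (@integration_by_substitution_increasing _ (fun t => c * expR t) G) => //.
      * by apply: eq_integral => t _; rewrite dF qE.
      * by move=> u v _ _; rewrite ltr_pM2l// ltr_expR.
      * by rewrite dF => t _; apply: cF.
      * by rewrite dF; apply: cvgP; apply: cvg_at_right_filter; apply: cF.
      * by rewrite dF; apply: cvgP; apply: cvg_at_left_filter; apply: cF.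
      * split.
        - by move=> t _; apply: derivableM.
        - by apply: cvg_at_right_filter; apply: cF.
        - by apply: cvg_at_left_filter; apply: cF.
      * exact: cGab.
    + have e0 : c * expR (- 0) = c by rewrite oppr0 expR0 mulr1.
      rewrite -{2}e0.
      rewrite (@integration_by_substitution_decreasing _ (fun t => c * expR (- t)) G) => //.
      * by apply: eq_integral => t _; rewrite dFN qE opprK.
      * by move=> u v _ _; rewrite ltr_pM2l// ltr_expR ltrN2.
      * by rewrite dFN => t _; apply: cvgN; apply: cFN.
      * by rewrite dFN; apply: cvgP; apply: cvgN; apply: cvg_at_right_filter; apply: cFN.
      * by rewrite dFN; apply: cvgP; apply: cvgN; apply: cvg_at_left_filter; apply: cFN.
      * split.
        - by move=> t _; apply: derivableM => //; apply: dexpN.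
        - by apply: cvg_at_right_filter; apply: cFN.
        - by apply: cvg_at_left_filter; apply: cFN.
      * exact: cGab.
  - apply: measurable_funS mG => // u /=; rewrite !in_itv/= andbT => /andP[+ _].
    exact: lt_le_trans.
  - by move=> u _; apply: G0.
  - apply/andP; split.
      by rewrite -[leRHS]mulr1 ler_pM2l// -[leRHS]expR0 ler_expR oppr_le0.
    by rewrite -[leLHS]mulr1 ler_pM2l// -[leLHS]expR0 ler_expR.
have limG : (\int[lebesgue_measure]_(t in `[0%R, i%:R]) (q t + q (- t))%:E)%E @[i --> \oo]
   --> (\int[lebesgue_measure]_(s in `]0%R, +oo[) (G s)%:E)%E.
  under eq_fun do rewrite step.
  apply: integral_exhaust => //.
  - by move=> i j ij; rewrite ler_pM2l// ler_expR lerN2 ler_nat.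
  - by move=> i j ij; rewrite ler_pM2l// ler_expR ler_nat.
  - move=> u /(exhaust_bound c0)[i /andP[h1 h2]]; exists i; apply/andP; split.
      apply: le_trans h1; rewrite expRN ler_pM2l// lef_pV2 ?posrE ?expR_gt0//.
      by rewrite -natr1 addrC expR_ge1Dx.
    by apply: le_trans h2 _; rewrite ler_pM2l// -natr1 addrC expR_ge1Dx.
have limq : (\int[lebesgue_measure]_(t in `[0%R, i%:R]) (q t + q (- t))%:E)%E @[i --> \oo]
   --> (\int[lebesgue_measure]_(t in `]0%R, +oo[) (q t + q (- t))%:E)%E.
  have mqq D : measurable D -> measurable_fun D (EFin \o (fun t : R => q t + q (- t))).
    by move=> mD; apply/measurable_EFinP; apply: measurable_funTS; apply: measurable_funD.
  rewrite integral_itv_obnd_cbnd; last exact: mqq.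
  rewrite (_ : `[0, +oo[%classic = \bigcup_(i : nat) `[0, i%:R]%classic); last first.
    apply/seteqP; split=> u; rewrite /= ?in_itv/= ?andbT.
      move=> u0; exists (Num.bound u) => //=; rewrite in_itv/= u0/=.
      exact/ltW/archi_boundP.
    by move=> [i _]; rewrite /= in_itv/= => /andP[].
  apply: ge0_nondecreasing_set_cvg_integral => //.
  - move=> i j ij; rewrite subsetEset => u /=; rewrite !in_itv/= => /andP[-> h]/=.
    by apply: le_trans h _; rewrite ler_nat.
  - by move=> i; apply: mqq.
  - by move=> i u _; rewrite lee_fin addr_ge0.
have intE : (\int[lebesgue_measure]_(s in `]0%R, +oo[) (G s)%:E =
  \int[lebesgue_measure]_(t in `]0%R, +oo[) (q t + q (- t))%:E)%E.
  by rewrite -(cvg_lim (@ereal_hausdorff R) limG) -(cvg_lim (@ereal_hausdorff R) limq).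
rewrite -/G /Rintegral intE /besselK /Rintegral -fine_mulr_EFin; last first.
  by rewrite mulr_gt0// powR_gt0.
congr fine; rewrite -ge0_integralZr//.
- apply: eq_integral => t _; rewrite -EFinM; congr EFin.
  by rewrite /q hcosC mulrN expRN -expRN /hcos; field.
- have mh : measurable_fun (setT : set R) (@hcos R) by apply: continuous_measurable_fun.
  apply/measurable_EFinP; apply: measurable_funTS; apply: measurable_funM.
    by apply: measurable_expR_fun; apply: measurable_funM.
  by apply: measurableT_comp => //; apply: measurable_funM.
- by move=> t _; rewrite lee_fin mulr_ge0 ?expR_ge0// /hcos divr_ge0// addr_ge0 ?expR_ge0.
- by rewrite lee_fin mulr_ge0 ?powR_ge0.
Qed.

(** The weight is the gamma density and phi s = nu / s, that is, the scale follows an inverse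
gamma law.  At t = 0 the formula reduces to the definition of the gamma function, in
agreement with the value 1 of the kernel. *)
Lemma matern_mixture (R : realType) (nu : R) : 1 <= nu -> gaussian_mixture (matern nu).
Proof.
move=> nu1; have nu0 : 0 < nu by lra.
have intw := integrable_gamma nu1.
have gamma0 : 0 < gamma_fun nu.
  by apply: Rintegral_gt0 => // s s0; rewrite mulr_gt0 ?powR_gt0 ?expR_gt0.
apply: (@mixture_of_weight _ _ (fun u => u `^ (nu - 1) * expR (- u)) (fun u => nu / u)
  (gamma_fun nu)) => //.
- apply: measurable_funM => //; apply: open_continuous_measurable_fun; first exact: interval_open.
  move=> u; rewrite inE/= in_itv/= andbT => u0.
  by apply: cvgV; [rewrite gt_eqF|exact: cvg_id].
- by move=> s s0; rewrite mulr_gt0 ?powR_gt0 ?expR_gt0// divr_gt0.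
move=> t; rewrite le_eqVlt => /predU1P[<-|t0].
  rewrite /matern eqxx mulr1; apply: eq_Rintegral => s _.
  by rewrite expr0n/= mulr0 oppr0 expR0 mulr1.
rewrite /matern gt_eqF//; set c := Num.sqrt nu * t.
have c0 : 0 < c by rewrite mulr_gt0 ?sqrtr_gt0.
have c2 : c ^+ 2 = nu * t ^+ 2 by rewrite exprMn sqr_sqrtr ?ltW.
have -> : 2 * Num.sqrt nu * t = 2 * c by rewrite /c mulrA.
rewrite -!mulrA mulVKf ?lt0r_neq0// mulrA powRM ?ltW// mulrA.
rewrite -powRD; last by rewrite pnatr_eq0 implybT.
rewrite subrK powRr1// -(integral_bessel nu1 c0).
by apply: eq_Rintegral => s _; rewrite c2 (mulrAC nu).
Qed.

Lemma smooth_kernel_mixture (R : realType) (K : R -> R) :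
  smooth_kernel K -> gaussian_mixture K.
Proof.
case=> [nu nu0 ->|->|nu nu1 ->].
- exact: rational_quadratic_mixture.
- exact: squared_exponential_mixture.
- exact: matern_mixture.
Qed.

(** * Gaussian integrals and the profile quadratic form *)

Lemma gaussian_integral1 (R : realType) (c k mu0 : R) : 0 <= c -> 0 < k ->
  (\int[lebesgue_measure]_(b in setT) (c * expR (- 2^-1 * (k * (b - mu0) ^+ 2)))%:E)%E
  = (c * (Num.sqrt (2 * pi) / Num.sqrt k))%:E.
Proof.
move=> c0 k0; set s := (Num.sqrt k)^-1.
have sk0 : 0 < Num.sqrt k by rewrite sqrtr_gt0.
have s0 : s != 0 by rewrite invr_eq0 lt0r_neq0.
have skk : Num.sqrt k ^+ 2 = k by rewrite sqr_sqrtr// ltW.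
have pi0 : 0 < pi :> R by exact: pi_gt0.
have peakE : (normal_peak s)^-1 = Num.sqrt (2 * pi) / Num.sqrt k.
  rewrite /normal_peak invrK -mulr_natl mulrCA sqrtrM ?sqr_ge0// sqrtr_sqr.
  rewrite gtr0_norm ?invr_gt0// mulrC; congr (Num.sqrt _ * _).
have E : (fun b => (c * expR (- 2^-1 * (k * (b - mu0) ^+ 2)))%:E) =
    (fun b => (c / normal_peak s)%:E * (normal_pdf mu0 s b)%:E)%E.
  apply/funext => b; rewrite -EFinM normal_pdfE//= /normal_fun; congr EFin.
  rewrite -!mulrA mulKf ?lt0r_neq0 ?normal_peak_gt0//; congr (_ * expR _).
  by rewrite /s exprVn skk; field; rewrite lt0r_neq0.
rewrite E ge0_integralZl//.
- by rewrite integral_normal_pdf mule1 peakE.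
- by apply/measurable_EFinP; exact: measurable_normal_pdf.
- by move=> b _; rewrite lee_fin normal_pdf_ge0.
- by rewrite lee_fin divr_ge0// ltW// normal_peak_gt0.
Qed.

(** Block elimination of the first coordinate: k is the Schur complement of the lower right
block, and the substitution e + d * h completes the square. *)
Lemma pd_block (R : realType) p (G : 'M[R]_(1 + p)) : G^T = G ->
  (forall t : 'cV_(1 + p), t != 0 -> 0 < (t^T *m G *m t) 0 0) ->
  exists (k : R) (h : 'cV[R]_p),
    [/\ 0 < k, \det G = k * \det (drsubmx G),
      (drsubmx G)^T = drsubmx G,
      (forall t : 'cV_p, t != 0 -> 0 < (t^T *m drsubmx G *m t) 0 0) &
      forall (d : R) (e : 'cV_p),
        ((col_mx d%:M e)^T *m G *m col_mx d%:M e) 0 0 =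
        k * d ^+ 2 + ((e + d *: h)^T *m drsubmx G *m (e + d *: h)) 0 0].
Proof.
move=> Gsym pdG; set G' := drsubmx G.
have G'sym : G'^T = G' by rewrite /G' trmx_drsub Gsym.
have GE : G = block_mx (ulsubmx G) (ursubmx G) (dlsubmx G) G' by rewrite submxK.
have G'pd (t : 'cV_p) : t != 0 -> 0 < (t^T *m G' *m t) 0 0.
  move=> t0; have := pdG (col_mx 0 t); rewrite {1}GE tr_col_mx.
  rewrite mul_row_block mul_row_col trmx0 !mul0mx !add0r !mulmx0 add0r; apply.
  by apply: contra_neq t0 => /eqP; rewrite col_mx_eq0 => /andP[_ /eqP].
have G'unit := pd_unitmx G'pd.
pose g := ulsubmx G; pose k := dlsubmx G.
have kT : ursubmx G = k^T by rewrite /k trmx_dlsub Gsym.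
pose h := invmx G' *m k.
have G'h : G' *m h = k by rewrite /h mulKVmx.
have hG' : h^T *m G' = k^T by rewrite -[in RHS]G'h [RHS]trmx_mul G'sym.
pose kappa := g - k^T *m h.
(* T^T G T is block diagonal. *)
pose T : 'M[R]_(1 + p) := block_mx 1%:M 0 (- h) 1%:M.
have GT : G *m T = block_mx kappa k^T 0 G'.
  rewrite {1}GE -/g -/k kT mulmx_block !mulmx1 !mulmx0 !mulmxN !add0r.
  by rewrite G'h subrr.
have detT : \det T = 1 by rewrite det_lblock !det1 mulr1.
have TGT : T^T *m G *m T = block_mx kappa 0 0 G'.
  rewrite -mulmxA GT tr_block_mx mulmx_block !trmx1 !trmx0 !mul1mx !mul0mx !mulmx0 !addr0 add0r.
  by rewrite linearN /= mulNmx hG' subrr.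
have quadT (w : 'cV[R]_(1 + p)) :
    (T *m w)^T *m G *m (T *m w) = w^T *m (block_mx kappa 0 0 G') *m w.
  by rewrite -TGT trmx_mul !mulmxA.
have blockE (d : R) (e : 'cV_p) :
    ((col_mx d%:M e)^T *m block_mx kappa 0 0 G' *m col_mx d%:M e) 0 0 =
    kappa 0 0 * d ^+ 2 + (e^T *m G' *m e) 0 0.
  rewrite tr_col_mx mul_row_block !mulmx0 addr0 add0r mul_row_col mxE; congr (_ + _).
  rewrite tr_scalar_mx mul_scalar_mx mul_mx_scalar !mxE; ring.
exists (kappa 0 0), h; split=> //.
- have := pdG (T *m col_mx 1%:M 0); rewrite quadT blockE.
  have z (v : 'cV[R]_p) : v = 0 -> (v^T *m G' *m v) 0 0 = 0.
    by move=> ->; rewrite trmx0 !mul0mx mxE.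
  rewrite (z 0 erefl) addr0 expr1n mulr1; apply.
  apply/eqP => /(congr1 (mulmx (invmx T))); rewrite mulKmx; last first.
    by rewrite unitmxE detT unitr1.
  rewrite mulmx0 => /eqP; rewrite col_mx_eq0 => /andP[/eqP/matrixP/(_ 0 0)].
  by rewrite !mxE eqxx => /eqP; rewrite oner_eq0.
- have := congr1 determinant GT; rewrite det_mulmx detT mulr1 det_ublock => ->.
  by congr (_ * _); rewrite det_mx11.
- move=> d e; rewrite -blockE.
  have -> : col_mx d%:M e = T *m col_mx d%:M (e + d *: h).
    rewrite /T mul_block_col !mul1mx mul0mx addr0; congr col_mx.
    by rewrite mulNmx mul_mx_scalar addrC addrK.
  by rewrite quadT.
Qed.

(** Integrate out all coordinates but the first by induction, then the first one; the
determinant factors accordingly through the Schur complement.  The constant c is carried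
along so that the induction hypothesis applies for each value of the first coordinate. *)
Lemma gaussian_integral (R : realType) p (G : 'M[R]_p) (b : 'cV[R]_p) (c : R) :
  0 <= c -> G^T = G -> (forall t : 'cV_p, t != 0 -> 0 < (t^T *m G *m t) 0 0) ->
  0 < \det G /\
  integral_cV (fun beta : 'cV[R]_p =>
    (c * expR (- 2^-1 * ((beta - b)^T *m G *m (beta - b)) 0 0))%:E)
  = (c * (Num.sqrt (2 * pi) ^+ p / Num.sqrt (\det G)))%:E.
Proof.
elim: p G b c => [|p IH] G b c c0 Gsym pdG.
  rewrite /= det_mx00 sqrtr1 divr1 expr0 mulr1; split=> //.
  by rewrite (_ : 0 - b = 0) ?mulmx0 ?mxE ?mulr0 ?expR0 ?mulr1//; apply/colP => -[].
pose G' : 'M[R]_p := @drsubmx R 1 p 1 p G.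
have [k [h [k0 detG G'sym G'pd quadE]]] := @pd_block R p G Gsym pdG.
have [detG' _] := IH G' 0 c c0 G'sym G'pd.
split; first by rewrite detG mulr_gt0.
pose b0 : R := @usubmx R 1 p 1 b 0 0; pose b1 := @dsubmx R 1 p 1 b.
have bE : b = col_mx b0%:M b1.
  by rewrite -[LHS](@vsubmxK R 1 p 1) [in LHS](mx11_scalar (usubmx _)).
have key (a : R) (beta : 'cV[R]_p) :
    (((col_mx a%:M beta : 'cV[R]_p.+1) - b)^T *m G *m (col_mx a%:M beta - b)) 0 0 =
    k * (a - b0) ^+ 2 + ((beta - (b1 - (a - b0) *: h))^T *m G' *m
                         (beta - (b1 - (a - b0) *: h))) 0 0.
  have -> : (col_mx a%:M beta : 'cV[R]_p.+1) - b = col_mx (a - b0)%:M (beta - b1).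
    have gen (u v : 'M[R]_1) (w z : 'cV[R]_p) :
        (col_mx u w : 'cV[R]_(1 + p)) - col_mx v z = col_mx (u - v) (w - z).
      by rewrite opp_col_mx add_col_mx.
    by rewrite bE; apply: etrans (gen _ _ _ _) _; rewrite raddfB.
  by rewrite quadE opprB addrA (addrAC beta).
transitivity (\int[lebesgue_measure]_(a in setT)
  ((c * (Num.sqrt (2 * pi) ^+ p / Num.sqrt (\det G'))) *
   expR (- 2^-1 * (k * (a - b0) ^+ 2)))%:E)%E.
  apply: eq_integral => a _.
  rewrite mulrAC -(IH G' (b1 - (a - b0) *: h) _ _ G'sym G'pd).2 ?mulr_ge0 ?expR_ge0//.
  congr integral_cV; apply/funext => beta; congr EFin.
  by rewrite key mulrDr expRD mulrA.
rewrite gaussian_integral1//; last first.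
  by rewrite mulr_ge0// divr_ge0 ?exprn_ge0 ?sqrtr_ge0.
congr EFin; rewrite detG (sqrtrM _ (ltW k0)) exprSr invfM -/G'; ring.
Qed.

Lemma col_free_inj (R : realType) n p (H : 'M[R]_(n, p)) (b : 'cV[R]_p) :
  \rank H = p -> H *m b = 0 -> b = 0.
Proof.
move=> rankH Hb; have Hfree : row_free H^T by rewrite /row_free mxrank_tr rankH.
apply: trmx_inj; rewrite trmx0; apply: (row_free_inj Hfree).
by rewrite -trmx_mul Hb mul0mx trmx0.
Qed.

Lemma pd_congr (R : realType) n p (P : 'M[R]_n) (H : 'M[R]_(n, p)) :
  (forall z : 'cV_n, z != 0 -> 0 < (z^T *m P *m z) 0 0) ->
  (forall b : 'cV_p, H *m b = 0 -> b = 0) ->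
  forall b : 'cV_p, b != 0 -> 0 < (b^T *m (H^T *m P *m H) *m b) 0 0.
Proof.
move=> pdP Hinj b b0; rewrite !mulmxA -trmx_mul -mulmxA; apply: pdP.
by apply: contra_neq b0; apply: Hinj.
Qed.

Lemma pd_inv (R : realType) n (S : 'M[R]_n) : S^T = S ->
  (forall z : 'cV_n, z != 0 -> 0 < (z^T *m S *m z) 0 0) ->
  forall z : 'cV_n, z != 0 -> 0 < (z^T *m invmx S *m z) 0 0.
Proof.
move=> Ssym pdS z z0; have Sunit := pd_unitmx pdS.
have : invmx S *m z != 0.
  by apply: contra_neq z0 => Sz; rewrite -[z](mulKVmx Sunit) Sz mulmx0.
move/pdS; rewrite trmx_mul trmx_inv Ssym -[_ *m S]mulmxA mulVmx// mulmx1.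
by rewrite mulmxA.
Qed.

(** The kernel of H^T contains the column space of W and has the same dimension m. *)
Lemma orth_complement (R : realType) n p m (H : 'M[R]_(n, p)) (W : 'M[R]_(n, m)) (e : 'cV[R]_n) :
  n = (p + m)%N -> \rank H = p -> W^T *m W = 1%:M -> H^T *m W = 0 ->
  H^T *m e = 0 -> exists t : 'cV_m, e = W *m t.
Proof.
move=> nE rankH WtW HtW Hte.
have rankW : \rank W^T = m.
  apply/eqP; rewrite eqn_leq rank_leq_row -{1}(mxrank1 R m) -WtW; exact: mxrankM_maxl.
have Wker : (W^T <= kermx H)%MS.
  by apply/sub_kermxP; rewrite -[LHS]trmxK trmx_mul trmxK HtW trmx0.
have kerW : (kermx H <= W^T)%MS.
  by rewrite -(geq_leqif (mxrank_leqif_sup Wker)) mxrank_ker rankH rankW nE addKn.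
have eker : (e^T <= kermx H)%MS.
  by apply/sub_kermxP; rewrite -[LHS]trmxK trmx_mul trmxK Hte trmx0.
have /submxP[D eD] := submx_trans eker kerW.
by exists D^T; rewrite -[LHS]trmxK eD trmx_mul trmxK.
Qed.

(** The vector b is the generalised least squares estimate.  Its residual e satisfies
H^T S^-1 e = 0, hence S^-1 e = W t for some t, and W^T y = W^T S W t determines t. *)
Lemma profile_quad (R : realType) n p m (S : 'M[R]_n) (H : 'M[R]_(n, p)) (W : 'M[R]_(n, m))
    (y : 'cV[R]_n) :
  n = (p + m)%N -> \rank H = p -> W^T *m W = 1%:M -> H^T *m W = 0 ->
  S^T = S -> (forall z : 'cV_n, z != 0 -> 0 < (z^T *m S *m z) 0 0) ->
  exists b : 'cV_p, forall beta : 'cV_p,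
    ((y - H *m beta)^T *m invmx S *m (y - H *m beta)) 0 0 =
    (y^T *m W *m invmx (W^T *m S *m W) *m W^T *m y) 0 0 +
    ((beta - b)^T *m (H^T *m invmx S *m H) *m (beta - b)) 0 0.
Proof.
move=> nE rankH WtW HtW Ssym pdS.
have Hinj := @col_free_inj _ _ _ H ^~ rankH.
have Sunit := pd_unitmx pdS; have pdP := pd_inv Ssym pdS.
pose P := invmx S; pose G := H^T *m P *m H.
have Psym : P^T = P by rewrite /P trmx_inv Ssym.
have pdG := pd_congr pdP Hinj; have Gunit : G \in unitmx := pd_unitmx pdG.
have pdM := pd_congr pdS (fun b => @isometry_inj _ _ _ W b WtW).
have Munit := pd_unitmx pdM; set M := W^T *m S *m W in pdM Munit *.
pose b := invmx G *m (H^T *m P *m y); pose e := y - H *m b.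
have He : H^T *m (P *m e) = 0.
  by rewrite /e mulmxA mulmxBr [_ *m (H *m b)]mulmxA -/G /b mulKVmx// subrr.
have [t Pe] := orth_complement nE rankH WtW HtW He.
have eE : e = S *m (W *m t) by rewrite -Pe mulKVmx.
have WtH : W^T *m H = 0 by rewrite -[LHS]trmxK trmx_mul trmxK HtW trmx0.
have Wty : W^T *m y = M *m t.
  rewrite -(subrK (H *m b) y) -/e mulmxDr [_ *m (H *m b)]mulmxA WtH mul0mx addr0.
  by rewrite eE !mulmxA.
have tE : t = invmx M *m (W^T *m y) by rewrite Wty mulKmx.
exists b => beta.
have -> : y - H *m beta = e - H *m (beta - b).
  by rewrite /e mulmxBr opprB addrA subrK.
set d := beta - b.
have trB (u v : 'cV[R]_n) : (u - v)^T = u^T - v^T by rewrite raddfB.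
have dPe : (H *m d)^T *m P *m e = 0 by rewrite trmx_mul -!mulmxA He mulmx0.
have ePd : e^T *m P *m (H *m d) = 0.
  have -> : e^T *m P = t^T *m W^T by rewrite -trmx_mul -Pe trmx_mul Psym.
  by rewrite -mulmxA [W^T *m _]mulmxA WtH mul0mx mulmx0.
have -> : (e - H *m d)^T *m invmx S *m (e - H *m d) =
    e^T *m P *m e + (H *m d)^T *m P *m (H *m d).
  rewrite -/P trB mulmxBl mulmxBr !mulmxBl dPe ePd.
  by rewrite subr0 sub0r opprK.
rewrite mxE; congr (_ + _); last by rewrite trmx_mul !mulmxA.
have eW : e^T *m W = y^T *m W.
  by rewrite /e trB mulmxBl trmx_mul -mulmxA HtW mulmx0 subr0.
by rewrite -mulmxA Pe mulmxA eW tE !mulmxA.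
Qed.

(** Compute the determinant of C = [H, S W] in two ways: against [H, W]^T, and through
C^T S^-1 C, which is block diagonal. *)
Lemma profile_det (R : realType) n p m (S : 'M[R]_n) (H : 'M[R]_(n, p)) (W : 'M[R]_(n, m)) :
  n = (p + m)%N -> W^T *m W = 1%:M -> H^T *m W = 0 -> S^T = S -> S \in unitmx ->
  H^T *m H \in unitmx -> W^T *m S *m W \in unitmx ->
  \det S * \det (H^T *m invmx S *m H) = \det (H^T *m H) * \det (W^T *m S *m W).
Proof.
move=> nE WtW HtW Ssym Sunit; subst n.
set M := W^T *m S *m W; rewrite !unitmxE !unitfE => HHunit Munit.
have WtH : W^T *m H = 0 by rewrite -[LHS]trmxK trmx_mul trmxK HtW trmx0.
pose B := row_mx H W; pose C := row_mx H (S *m W).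
have BC : \det B * \det C = \det (H^T *m H) * \det M.
  rewrite -[\det B]det_tr -det_mulmx /B /C tr_row_mx mul_col_row WtH det_ublock.
  by rewrite mulmxA.
have BB : \det B ^+ 2 = \det (H^T *m H).
  rewrite expr2 -{1}[\det B]det_tr -det_mulmx /B tr_row_mx mul_col_row WtH HtW WtW.
  by rewrite det_ublock det1 mulr1.
have CPC : \det C ^+ 2 * \det (invmx S) = \det (H^T *m invmx S *m H) * \det M.
  rewrite expr2 mulrAC -{1}[\det C]det_tr -!det_mulmx /C tr_row_mx mul_col_mx mul_col_row.
  rewrite [H^T *m invmx S *m (S *m W)]mulmxA mulmxKV// HtW det_lblock trmx_mul Ssym.
  by rewrite -[W^T *m S *m invmx S]mulmxA mulmxV// mulmx1 mulmxA.
have Sdet : \det S * \det (invmx S) = 1 by rewrite -det_mulmx mulmxV// det1.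
have CC : \det C ^+ 2 = \det (H^T *m H) * \det M ^+ 2.
  apply: (mulfI HHunit); rewrite -{1}BB -exprMn BC; ring.
apply: (mulIf Munit); rewrite -mulrA -CPC CC.
rewrite mulrCA Sdet; ring.
Qed.

(** * The integrated likelihood *)

(** The integrand in the variance u once beta has been integrated out, q being the quadratic
form in the data. *)
Definition radial (R : realType) (m : nat) (q u : R) : R :=
  (2 * pi * u) `^ (- (m%:R / 2)) * u^-1 * expR (- ((2 * u)^-1 * q)).

Lemma continuous_radial (R : realType) m (q u : R) : 0 < u ->
  {for u, continuous (radial m q)}.
Proof.
move=> u0; have p0 : 0 < 2 * pi :> R by rewrite mulr_gt0// pi_gt0.
have cV : {for u, continuous (fun v : R => v^-1)}.
  by apply: cvgV; [rewrite gt_eqF|exact: cvg_id].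
have cL k : {for u, continuous (fun v : R => k * v)}.
  by apply: cvgM; [exact: cvg_cst|exact: cvg_id].
have c1 : {for u, continuous (fun v : R => (2 * pi * v) `^ (- (m%:R / 2)))}.
  apply: (@continuous_comp _ _ _ (fun v : R => 2 * pi * v) (fun w : R => w `^ (- (m%:R / 2)))).
    exact: cL.
  by apply: continuous_powR_gt0; rewrite mulr_gt0.
have c2 : {for u, continuous (fun v : R => expR (- ((2 * v)^-1 * q)))}.
  apply: continuous_expR_fun; apply: cvgN; apply: cvgM; last exact: cvg_cst.
  by apply: cvgV; [rewrite gt_eqF ?mulr_gt0|exact: cL].
exact: (cvgM (cvgM c1 cV) c2).
Qed.

Lemma radial_ge0 (R : realType) m (q u : R) : 0 < u -> 0 <= radial m q u.
Proof. by move=> u0; rewrite !mulr_ge0 ?powR_ge0 ?expR_ge0 ?invr_ge0 ?ltW. Qed.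

Lemma measurable_radial (R : realType) m (q : R) :
  measurable_fun (`]0, +oo[ : set R) (radial m q).
Proof.
apply: open_continuous_measurable_fun; first exact: interval_open.
by move=> u; rewrite inE/= in_itv/= andbT; apply: continuous_radial.
Qed.

(** Near infinity the integrand decays like u^(- m/2 - 1); near 0 the exponential in 1/u wins. *)
Lemma integrable_radial (R : realType) m : (0 < m)%N ->
  (@lebesgue_measure R).-integrable `]0, +oo[ (EFin \o radial m 1).
Proof.
move=> m0; have [C C0 hC] := exprn_le_expR R (m + 2).
have p0 : 0 < 2 * pi :> R by rewrite mulr_gt0// pi_gt0.
pose a : R := m%:R / 2.
have m1 : 1 <= m%:R :> R by rewrite ler1n.
apply: (integrable_le_tail (C := (2 * pi) `^ (- a) * C)); first exact: measurable_radial.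
move=> u u0; rewrite ger0_norm ?radial_ge0// /radial -/a.
rewrite powRM ?(ltW p0) ?(ltW u0)// -!mulrA; apply: ler_wpM2l; first exact: powR_ge0.
(* In the variable x = 1/u the claim is a comparison of powers with exp (x/2). *)
pose x := u^-1; have x0 : 0 < x by rewrite invr_gt0.
have e1 k : u `^ (- k) = x `^ k.
  by rewrite /x -powR_inv1 ?(ltW u0)// -powRrM mulN1r.
have e2 : (1 + u) `^ (- (3 / 2)) = (1 + x) `^ (- (3 / 2)) * x `^ (3 / 2).
  rewrite -e1 -powRM ?(ltW u0) ?addr_ge0 ?(ltW x0)//.
  by congr (_ `^ _); rewrite mulrDl /x mulVf ?lt0r_neq0// mul1r addrC.
have e3 : expR (- ((2 * u)^-1 * 1)) = expR (- (x / 2)).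
  by rewrite invfM mulr1 mulrC.
rewrite e1 e2 e3 -/x.
have y0 : 0 < 1 + x by lra.
have y1 : 1 <= 1 + x by lra.
rewrite mulrA -ler_pdivlMr ?expR_gt0// -expRN opprK.
have hx : x `^ a * x = x `^ (3 / 2) * x `^ (a - 1 / 2).
  rewrite -powRD ?(lt0r_neq0 x0) ?implybT//.
  rewrite -{2}[x]powRr1 ?(ltW x0)// -powRD ?(lt0r_neq0 x0) ?implybT//.
  by congr (_ `^ _); lra.
rewrite hx [leRHS](_ : _ = x `^ (3 / 2) *
    ((1 + x) `^ (- (3 / 2)) * (C * expR (x / 2)))); last by ring.
apply: ler_wpM2l; first exact: powR_ge0.
rewrite powRN ler_pdivlMl ?powR_gt0//.
apply: le_trans (hC x (ltW x0)).
apply: (@le_trans _ _ ((1 + x) `^ (3 / 2) * (1 + x) `^ (a - 1 / 2))).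
  apply: ler_wpM2l; first exact: powR_ge0.
  by apply: ge0_ler_powR; rewrite ?nnegrE /a; lra.
rewrite -powRD ?(lt0r_neq0 y0) ?implybT// -powR_mulrn ?(ltW y0)//.
by apply: ler_powR => //; rewrite natrD /a; lra.
Qed.

(** Substitute u = q * v. *)
Lemma integral_radial (R : realType) m (q : R) : (0 < m)%N -> 0 < q ->
  (\int[lebesgue_measure]_(u in `]0%R, +oo[) (radial m q u)%:E)%E =
  (q `^ (- (m%:R / 2)) * \int[lebesgue_measure]_(u in `]0, +oo[) radial m 1 u)%:E.
Proof.
move=> m0 q0; have intr := integrable_radial R m0.
have p0 : 0 < 2 * pi :> R by rewrite mulr_gt0// pi_gt0.
rewrite -(@integral_scale _ _ q) //; first last.
- by move=> u; apply: radial_ge0.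
- by move=> u; rewrite in_itv/= andbT; apply: continuous_radial.
rewrite EFinM /Rintegral fineK; last exact: integrable_fin_num.
rewrite -ge0_integralZl//.
- apply: eq_integral => u; rewrite inE/= in_itv/= andbT => u0.
  rewrite -EFinM; congr EFin; rewrite /radial mulr1.
  have pu0 : 0 <= 2 * pi * u by rewrite mulr_ge0 ?(ltW p0) ?(ltW u0).
  rewrite (mulrCA (2 * pi)) (powRM _ (ltW q0) pu0) !invfM.
  have -> : 2^-1 * (q^-1 * u^-1) * q = 2^-1 * u^-1 by field; rewrite !lt0r_neq0.
  by field; rewrite !lt0r_neq0.
- by apply/measurable_EFinP; exact: measurable_radial.
- by move=> u; rewrite /= in_itv/= andbT lee_fin; apply: radial_ge0.
- by rewrite lee_fin powR_ge0.
Qed.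

Lemma integrated_likelihoodE (R : realType) n p m (S : 'M[R]_n) (H : 'M[R]_(n, p))
    (W : 'M[R]_(n, m)) (y : 'cV[R]_n) :
  (0 < m)%N -> n = (p + m)%N -> \rank H = p -> W^T *m W = 1%:M -> H^T *m W = 0 ->
  S^T = S -> (forall z : 'cV_n, z != 0 -> 0 < (z^T *m S *m z) 0 0) ->
  let q := (y^T *m W *m invmx (W^T *m S *m W) *m W^T *m y) 0 0 in
  0 < q ->
  integrated_likelihood H S y =
  ((\det S) `^ (- 2^-1) / Num.sqrt (\det (H^T *m invmx S *m H)) *
   (q `^ (- (m%:R / 2)) * \int[lebesgue_measure]_(u in `]0, +oo[) radial m 1 u))%:E.
Proof.
move=> m0 nE rankH WtW HtW Ssym pdS q q0.
have p0 : 0 < 2 * pi :> R by rewrite mulr_gt0// pi_gt0.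
have [b hb] := profile_quad y nE rankH WtW HtW Ssym pdS.
pose G := H^T *m invmx S *m H.
have Gsym : G^T = G by rewrite /G !trmx_mul trmxK trmx_inv Ssym mulmxA.
have pdG := pd_congr (pd_inv Ssym pdS) (fun b => @col_free_inj _ _ _ H b rankH).
have [detG _] := gaussian_integral 0 ler01 Gsym pdG.
pose A := (\det S) `^ (- 2^-1) / Num.sqrt (\det G).
transitivity (\int[lebesgue_measure]_(u in `]0%R, +oo[) (A%:E * (radial m q u)%:E))%E; last first.
  rewrite ge0_integralZl//; first by rewrite integral_radial// -EFinM.
  - by apply/measurable_EFinP; exact: measurable_radial.
  - by move=> u; rewrite /= in_itv/= andbT lee_fin; apply: radial_ge0.
  - by rewrite lee_fin divr_ge0 ?powR_ge0 ?sqrtr_ge0.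
apply: eq_integral => u; rewrite inE/= in_itv/= andbT => u0.
pose Gu := u^-1 *: G.
have Gusym : Gu^T = Gu by rewrite /Gu linearZ /= Gsym.
have GuE (t : 'cV_p) : (t^T *m Gu *m t) 0 0 = u^-1 * (t^T *m G *m t) 0 0.
  by rewrite /Gu -scalemxAr -scalemxAl mxE.
have pdGu (t : 'cV_p) : t != 0 -> 0 < (t^T *m Gu *m t) 0 0.
  by move=> t0; rewrite GuE mulr_gt0 ?invr_gt0// pdG.
pose c := (2 * pi * u) `^ (- (n%:R / 2)) * (\det S) `^ (- 2^-1) * expR (- ((2 * u)^-1 * q)).
have c0 : 0 <= c by rewrite !mulr_ge0 ?powR_ge0 ?expR_ge0.
have -> : (fun beta : 'cV[R]_p => (likelihood H S y beta u)%:E) =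
   (fun beta => (c * expR (- 2^-1 * ((beta - b)^T *m Gu *m (beta - b)) 0 0))%:E).
  apply/funext => beta; congr EFin; rewrite /likelihood /= hb GuE /c -!mulrA -expRD.
  congr (_ * (_ * expR _)); rewrite -/q -/G invfM; ring.
rewrite (gaussian_integral b c0 Gusym pdGu).2 -!EFinM; congr EFin.
have pu0 : 0 < 2 * pi * u by rewrite mulr_gt0.
have iu0 : 0 <= u^-1 by rewrite invr_ge0 ltW.
rewrite detZ (sqrtrM _ (exprn_ge0 p iu0)).
have sqrtX k (a : R) : 0 <= a -> Num.sqrt (a ^+ k) = Num.sqrt a ^+ k.
  move=> a0; elim: k => [|k IH]; first by rewrite !expr0 sqrtr1.
  by rewrite !exprS sqrtrM// IH.
rewrite (sqrtX p _ iu0) (sqrtrV (ltW u0)).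
have hp : (2 * pi * u) `^ (- (n%:R / 2)) * (Num.sqrt (2 * pi) ^+ p * Num.sqrt u ^+ p)
    = (2 * pi * u) `^ (- (m%:R / 2)).
  rewrite -exprMn -sqrtrM ?ltW// -powR12_sqrt ?ltW// -powR_mulrn ?powR_ge0// -powRrM.
  rewrite -powRD ?(lt0r_neq0 pu0) ?implybT//; congr (_ `^ _).
  by rewrite nE natrD; lra.
rewrite /A /radial -hp /c exprVn.
have su : Num.sqrt u ^+ p != 0 by rewrite expf_neq0// lt0r_neq0// sqrtr_gt0.
have sG : Num.sqrt (\det G) != 0 by rewrite lt0r_neq0// sqrtr_gt0.
by field; rewrite sG su lt0r_neq0.
Qed.

Lemma gram_det_gt0 (R : realType) n p (H : 'M[R]_(n, p)) :
  \rank H = p -> 0 < \det (H^T *m H).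
Proof.
move=> rankH; have Hinj b := @col_free_inj _ _ _ H b rankH.
have pd1 (z : 'cV[R]_n) : z != 0 -> 0 < (z^T *m 1%:M *m z) 0 0.
  by move=> z0; rewrite mulmx1 -sqlen_mx sqlen_gt0.
have pdHH (b : 'cV[R]_p) : b != 0 -> 0 < (b^T *m (H^T *m H) *m b) 0 0.
  by move=> b0; have := pd_congr pd1 Hinj b0; rewrite mulmx1.
have HHsym : (H^T *m H)^T = H^T *m H by rewrite trmx_mul trmxK.
by have [] := gaussian_integral 0 ler01 HHsym pdHH.
Qed.

Lemma integrated_likelihood_sqr (R : realType) n p m (S : 'M[R]_n) (H : 'M[R]_(n, p))
    (W : 'M[R]_(n, m)) (y : 'cV[R]_n) :
  (0 < m)%N -> n = (p + m)%N -> \rank H = p -> W^T *m W = 1%:M -> H^T *m W = 0 ->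
  S^T = S -> (forall z : 'cV_n, z != 0 -> 0 < (z^T *m S *m z) 0 0) ->
  let q := (y^T *m W *m invmx (W^T *m S *m W) *m W^T *m y) 0 0 in
  0 < q ->
  integrated_likelihood H S y \is a fin_num /\
  fine (integrated_likelihood H S y) ^+ 2 =
  (\int[lebesgue_measure]_(u in `]0, +oo[) radial m 1 u) ^+ 2 / \det (H^T *m H)
   / (\det (W^T *m S *m W) * q ^+ m).
Proof.
move=> m0 nE rankH WtW HtW Ssym pdS q q0.
rewrite (integrated_likelihoodE (W := W))//; split=> //; rewrite -/q [fine _]/=.
set J := Rintegral _ _ _.
have Hinj b := @col_free_inj _ _ _ H b rankH.
pose G := H^T *m invmx S *m H.
have Gsym : G^T = G by rewrite /G !trmx_mul trmxK trmx_inv Ssym mulmxA.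
have pdG := pd_congr (pd_inv Ssym pdS) Hinj.
have [detG _] := gaussian_integral 0 ler01 Gsym pdG.
have [detS _] := gaussian_integral 0 ler01 Ssym pdS.
have pdM := pd_congr pdS (fun b => @isometry_inj _ _ _ W b WtW).
have HHunit : H^T *m H \in unitmx by rewrite unitmxE unitfE lt0r_neq0// gram_det_gt0.
have Munit := pd_unitmx pdM.
have := profile_det nE WtW HtW Ssym (pd_unitmx pdS) HHunit Munit.
rewrite -/G => detE.
have hS : ((\det S) `^ (- 2^-1)) ^+ 2 = (\det S)^-1.
  rewrite -powR_mulrn ?powR_ge0// -powRrM (_ : - 2^-1 * 2%:R = -1); last by lra.
  by rewrite powR_inv1// ltW.
have hq : (q `^ (- (m%:R / 2))) ^+ 2 = (q ^+ m)^-1.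
  rewrite -powR_mulrn ?powR_ge0// -powRrM (_ : - (m%:R / 2) * 2%:R = - m%:R); last by lra.
  by rewrite powR_invn// ltW.
rewrite !exprMn exprVn hS hq (sqr_sqrtr (ltW detG)) -invfM detE.
have q1 : q ^+ m != 0 by rewrite expf_neq0// lt0r_neq0.
have d1 : \det (H^T *m H) != 0 by rewrite -unitfE -unitmxE.
have d2 : \det (W^T *m S *m W) != 0 by rewrite -unitfE -unitmxE.
by field; rewrite q1 d1 d2.
Qed.

(** * Bounds uniform in the range parameter *)

Lemma corr_mx_sym (R : realType) n r (K : R -> R) (x : 'I_n -> 'rV[R]_r) theta :
  (corr_mx K x theta)^T = corr_mx K x theta.
Proof.
apply/matrixP => i j; rewrite !mxE; congr (K (Num.sqrt _ / _)).
by apply: eq_bigr => k _; rewrite !mxE; ring.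
Qed.

Lemma corr_mx_pd (R : realType) n r (K : R -> R) (x : 'I_n -> 'rV[R]_r) theta :
  gaussian_mixture K -> injective x -> 0 < theta ->
  forall z : 'cV_n, z != 0 -> 0 < (z^T *m corr_mx K x theta *m z) 0 0.
Proof.
move=> mixK x_inj theta0 z z0.
have n0 : (0 < n)%N.
  rewrite lt0n; apply/eqP => n0; move/eqP: z0; apply; apply/colP => i.
  by have := ltn_ord i; rewrite [X in (_ < X)%N]n0.
have W1 : (1%:M : 'M[R]_n)^T *m 1%:M = 1%:M by rewrite trmx1 mul1mx.
have [t0 _ [c [C [c0 _ /(_ _ theta0)[h h0 [hlb _]]]]]] := mixture_pinch mixK n0 n0 x_inj W1.
rewrite -bilin_mx -/(quad _ _); have := hlb z; rewrite mul1mx.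
by apply: lt_le_trans; rewrite !mulr_gt0// sqlen_gt0.
Qed.

Lemma eigenvalue_ge (R : realType) m (M : 'M[R]_m) (a c : R) : M^T = M ->
  root (char_poly M) a -> (forall t : 'cV_m, c * sqlen (t^~ 0) <= (t^T *m M *m t) 0 0) ->
  c <= a.
Proof.
move=> Msym; rewrite -eigenvalue_root_char => /eigenvalueP[u uM u0] hM.
have ut0 : 0 < sqlen (u^T^~ 0) by rewrite sqlen_gt0// trmx_eq0.
have := hM u^T; rewrite trmxK uM -scalemxAl mxE -{2}[u]trmxK -sqlen_mx.
by rewrite ler_pM2r.
Qed.

Lemma ordered_eigenvalues_size (R : realType) m (M : 'M[R]_m) s :
  ordered_eigenvalues M s -> size s = m.
Proof.
move=> [_ chM]; apply: succn_inj; rewrite -(size_char_poly M) chM.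
by rewrite size_prod_XsubC.
Qed.

Lemma ordered_eigenvalues_det (R : realType) m (M : 'M[R]_m) s :
  ordered_eigenvalues M s -> \det M = \prod_(i < m) s`_i.
Proof.
move=> Ms; have sm := ordered_eigenvalues_size Ms; case: (Ms) => _ chM.
have := char_poly_det M; rewrite -horner_coef0 chM horner_prod.
under eq_bigr do rewrite !hornerE.
rewrite (big_nth 0) big_mkord sm prodrN card_ord => /mulfI -> //.
by rewrite signr_eq0.
Qed.

Lemma hyperplane_orthogonal (R : realType) n (w : 'cV[R]_n) : w != 0 ->
  exists2 Hn : {vspace 'cV[R]_n}, \dim Hn = n.-1 &
    forall y, y \notin Hn -> (y^T *m w) 0 0 != 0.
Proof.
move=> w0; pose f : 'Hom('cV[R]_n, 'M[R]_1) := linfun (mulmx w^T).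
have fE y : f y = w^T *m y by rewrite lfunE.
exists (lker f).
  have := limg_ker_dim f fullv; rewrite capfv dimvf /dim/= muln1.
  suff -> : \dim (limg f) = 1%N by rewrite addn1 => /(congr1 predn).
  apply/eqP; rewrite eqn_leq; apply/andP; split.
    by have := dimvS (subvf (limg f)); rewrite dimvf.
  rewrite lt0n dimv_eq0; apply: contraTneq (memv_img f (memvf w)) => ->.
  rewrite memv0 fE; apply: contraTneq (sqlen_gt0 w0) => ww.
  by rewrite sqlen_mx ww mxE ltxx.
move=> y; rewrite memv_ker fE; apply: contraNneq => yw.
apply/eqP/matrixP => i j; rewrite !ord1 -[w^T *m y]trmxK trmx_mul trmxK mxE.
by rewrite yw mxE.
Qed.

Lemma cauchy_schwarz_inv (R : realType) m (M : 'M[R]_m) (u t : 'cV[R]_m) : M^T = M ->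
  (forall t : 'cV_m, t != 0 -> 0 < (t^T *m M *m t) 0 0) ->
  (u^T *m t) 0 0 ^+ 2 <= (u^T *m invmx M *m u) 0 0 * (t^T *m M *m t) 0 0.
Proof.
move=> Msym pdM; have Munit := pd_unitmx pdM.
have Mfun i j : M i j = M j i by rewrite -{1}Msym mxE.
have := psd_cauchy_schwarz ((invmx M *m u)^~ 0) (t^~ 0) Mfun (pd_psd pdM).
rewrite /quad !bilin_mx trmx_mul trmx_inv Msym.
by rewrite -[_ *m M]mulmxA mulVmx// mulmx1 mulmxA.
Qed.

(** The two estimates hold for every theta > 0, not only asymptotically. *)
Lemma integrated_likelihood_bounds (R : realType) n r p (K : R -> R) (x : 'I_n -> 'rV[R]_r)
    (H : 'M[R]_(n, p)) m (W : 'M[R]_(n, m)) (v : R -> seq R) :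
  smooth_kernel K -> injective x -> (0 < m)%N -> n = (p + m)%N ->
  \rank H = p -> W^T *m W = 1%:M -> H^T *m W = 0 ->
  (forall theta : R, 0 < theta ->
     ordered_eigenvalues (W^T *m corr_mx K x theta *m W) (v theta)) ->
  exists2 Hn : {vspace 'cV[R]_n}, \dim Hn = n.-1 &
    forall y : 'cV[R]_n, y \notin Hn -> exists2 k : R, 0 < k & forall theta, 0 < theta ->
      let q := (y^T *m W *m invmx (W^T *m corr_mx K x theta *m W) *m W^T *m y) 0 0 in
      let vmin := (v theta)`_m.-1 in
      let L := integrated_likelihood H (corr_mx K x theta) y in
      [/\ 0 < q, 0 < vmin, q^-1 <= k * vmin, L \is a fin_num &
          fine L ^+ 2 <= k * \prod_(i < m) (vmin / (v theta)`_i)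
          /\ 0 <= \prod_(i < m) (vmin / (v theta)`_i)].
Proof.
move=> /smooth_kernel_mixture mixK x_inj m0 nE rankH WtW HtW hv.
have n0 : (0 < n)%N by rewrite nE addn_gt0 m0 orbT.
have [t0 t0_neq0 [c [C [c0 C0 pinch]]]] := mixture_pinch mixK n0 m0 x_inj WtW.
have Wt0 : W *m t0 != 0 by apply: contra_neq t0_neq0; apply: isometry_inj.
have [Hn dimHn HnP] := hyperplane_orthogonal Wt0.
exists Hn => // y /HnP; set a := (y^T *m (W *m t0)) 0 0 => a_neq0.
have a2 : 0 < a ^+ 2 by rewrite lt_def sqr_ge0 sqrf_eq0 a_neq0.
pose k1 := C / (c * a ^+ 2).
have k1_gt0 : 0 < k1 by rewrite divr_gt0// mulr_gt0.
pose k2 := (\int[lebesgue_measure]_(u in `]0, +oo[) radial m 1 u) ^+ 2 / \det (H^T *m H).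
have k2_ge0 : 0 <= k2 by rewrite divr_ge0 ?sqr_ge0// ltW// gram_det_gt0.
have k3_ge0 : 0 <= k2 * k1 ^+ m by rewrite mulr_ge0// exprn_ge0// ltW.
exists (k1 + k2 * k1 ^+ m); first lra.
move=> theta theta0 q vmin L.
have Ssym := corr_mx_sym K x theta; have pdS := corr_mx_pd mixK x_inj theta0.
set S := corr_mx K x theta in q L Ssym pdS *.
pose M := W^T *m S *m W.
have Msym : M^T = M by rewrite /M !trmx_mul trmxK Ssym mulmxA.
have pdM : forall t : 'cV_m, t != 0 -> 0 < (t^T *m M *m t) 0 0.
  exact: pd_congr pdS (fun b => @isometry_inj _ _ _ W b WtW).
have qM (t : 'cV[R]_m) : (t^T *m M *m t) 0 0 = quad S ((W *m t)^~ 0).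
  by rewrite /quad bilin_mx trmx_mul /M !mulmxA.
have [h h0 [hlb hub]] := pinch theta theta0.
have Mv := hv theta theta0; have sv := ordered_eigenvalues_size Mv.
have v_ge i : (i < m)%N -> c * h <= (v theta)`_i.
  move=> im; apply: (eigenvalue_ge Msym); last by move=> t; rewrite qM hlb.
  by case: Mv => _ ->; rewrite root_prod_XsubC mem_nth// sv.
have ch0 : 0 < c * h by rewrite mulr_gt0.
have v_gt0 : forall i, (i < m)%N -> 0 < (v theta)`_i.
  by move=> i im; apply: lt_le_trans ch0 (v_ge i im).
have vmin_ge : c * h <= vmin by apply: v_ge; rewrite prednK.
have vmin_gt0 : 0 < vmin by apply: lt_le_trans vmin_ge.
have aq : a ^+ 2 <= q * (C * h).
  have := cauchy_schwarz_inv (W^T *m y) t0 Msym pdM.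
  rewrite qM trmx_mul trmxK -[_ *m t0]mulmxA -/a => aq.
  have q_ge0 : 0 <= q.
    rewrite /q; have := pd_psd (pd_inv Msym pdM) ((W^T *m y)^~ 0).
    by rewrite /quad bilin_mx trmx_mul trmxK !mulmxA.
  apply: le_trans (ler_wpM2l q_ge0 hub).
  by move: aq; rewrite /q !mulmxA.
have q_gt0 : 0 < q.
  by have := lt_le_trans a2 aq; rewrite pmulr_lgt0// mulr_gt0.
have qinv : q^-1 <= k1 * vmin.
  apply: (@le_trans _ _ (C * h / a ^+ 2)).
    by rewrite ler_pdivlMr// mulrC ler_pdivrMr// mulrC.
  rewrite (_ : C * h / a ^+ 2 = k1 * (c * h)).
    by apply: ler_wpM2l => //; apply: ltW.
  by rewrite /k1; field; rewrite a_neq0 lt0r_neq0.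
have detM : \det M = \prod_(i < m) (v theta)`_i := ordered_eigenvalues_det Mv.
have prodE : \prod_(i < m) (vmin / (v theta)`_i) = vmin ^+ m / \det M.
  by rewrite prodf_div prodr_const card_ord detM.
have detM0 : 0 < \det M by rewrite detM; apply: prodr_gt0 => i _; apply: v_gt0.
have prod_ge0 : 0 <= \prod_(i < m) (vmin / (v theta)`_i).
  by rewrite prodE divr_ge0 ?exprn_ge0// ltW.
have [Lfin L2] := integrated_likelihood_sqr m0 nE rankH WtW HtW Ssym pdS q_gt0.
split=> //.
  apply: le_trans qinv _; apply: ler_wpM2r; first exact: ltW.
  by rewrite lerDl.
split=> //; rewrite L2.
apply: (@le_trans _ _ (k2 * k1 ^+ m * \prod_(i < m) (vmin / (v theta)`_i))); last first.
  by apply: ler_wpM2r => //; rewrite lerDr ltW.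
rewrite prodE -/M -/q -/k2 invfM.
rewrite (_ : k2 * k1 ^+ m * _ = k2 * ((\det M)^-1 * (k1 * vmin) ^+ m)); last first.
  by rewrite (exprMn m k1) (mulrC (\det M)^-1) !mulrA.
apply: ler_wpM2l => //; apply: ler_wpM2l; first by rewrite invr_ge0 ltW.
rewrite -exprVn; apply: lerXn2r => //; rewrite nnegrE.
- by rewrite invr_ge0 ltW.
- by rewrite mulr_ge0// ltW.
Qed.

Unset Implicit Arguments.
Set Strict Implicit.
Set Printing Implicit Defensive.

Theorem proposition4p3 (R : realType) (r n p : nat)
    (r_ge1 : (1 <= r)%N) (n_ge1 : (1 <= n)%N) (p_lt_n : (p < n)%N)
    (x : 'I_n -> 'rV[R]_r) (x_inj : injective x)
    (K : R -> R) (hK : smooth_kernel K)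
    (H : 'M[R]_(n, p)) (rankH : \rank H = p)
    (W : 'M[R]_(n, n - p)) (WtW : W^T *m W = 1%:M) (HtW : H^T *m W = 0)
    (v : R -> seq R)
    (hv : forall theta : R, 0 < theta ->
       ordered_eigenvalues (W^T *m corr_mx K x theta *m W) (v theta)) :
  let vmin := fun theta : R => (v theta)`_(n - p).-1 in
  let Q := fun (y : 'cV[R]_n) (theta : R) =>
    (y^T *m W *m invmx (W^T *m corr_mx K x theta *m W) *m W^T *m y) 0 0 in
  let L := fun (y : 'cV[R]_n) (theta : R) =>
    integrated_likelihood H (corr_mx K x theta) y in
  exists2 Hn : {vspace 'cV[R]_n}, \dim Hn = n.-1 &
    forall y : 'cV[R]_n, y \notin Hn ->
      [/\ \forall theta \near +oo, Q y theta != 0,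
          (fun theta => ((Q y theta)^-1)%R : R^o) =O_ (pinfty_nbhs R) (vmin : R -> R^o),
          \forall theta \near +oo, L y theta \is a fin_num
        & (fun theta => (fine (L y theta) ^+ 2)%R : R^o) =O_ (pinfty_nbhs R)
            (fun theta => (\prod_(i < n - p) (vmin theta / (v theta)`_i))%R : R^o)].
Proof.
move=> vmin Q L.
have m0 : (0 < n - p)%N by rewrite subn_gt0.
have nE : n = (p + (n - p))%N by rewrite subnKC// ltnW.
have [Hn dimHn HnP] := integrated_likelihood_bounds hK x_inj m0 nE rankH WtW HtW hv.
exists Hn => // y /HnP[k k0 bounds].
have near_pos (P : R -> Prop) :
    (forall theta, 0 < theta -> P theta) -> \forall theta \near +oo, P theta.
  by move=> HP; exists 0; split=> // theta; apply: HP.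
split.
- by apply: near_pos => theta /bounds[q0 _ _ _ _]; rewrite /Q lt0r_neq0.
- apply/eqO_exP; exists k => //; apply: near_pos => theta /bounds[q0 v0 qv _ _].
  by rewrite /Q /vmin !gtr0_norm ?invr_gt0.
- by apply: near_pos => theta /bounds[_ _ _ Lfin _].
- apply/eqO_exP; exists k => //; apply: near_pos => theta /bounds[_ _ _ _ [L2 P0]].
  by rewrite !ger0_norm ?sqr_ge0.
Qed.
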